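(* Let $\eta\in\mathbb{C}\setminus\{0\}$ and let $\alpha_0,\dots,\alpha_4\in\mathbb{C}$ satisfy $\alpha_0+\alpha_1+2\alpha_2+\alpha_3+\alpha_4=1$. Consider an ordinary differential system $$\frac{dx}{dt}=f_1(x,y,z),\quad \frac{dy}{dt}=f_2(x,y,z),\quad \frac{dz}{dt}=f_3(x,y,z)$$ where $f_1,f_2,f_3$ are polynomials in $x,y,z$ with coefficients in $\mathbb{C}(t)$. Assume: (A1) $\deg(f_i)=6$ with respect to $x,y,z$ for $i=1,2,3$; (A2) the right-hand side of the system becomes again a polynomial in each of the coordinate systems $(x_i,y_i,z_i)$, $i=0,1,\dots,4$, where 0) $x_0=x-\eta,\ y_0=y,\ z_0=z-\frac{\alpha_0}{x-\eta}$; 1) $x_1=x,\ y_1=y,\ z_1=z-\frac{\alpha_1}{x}$; 2) $x_2=x+\frac{\alpha_2}{z},\ y_2=y+\frac{\alpha_2}{z},\ z_2=z$; 3) $x_3=x,\ y_3=y-1,\ z_3=z-\frac{\alpha_3}{y-1}$; 4) $x_4=x,\ y_4=y,\ z_4=z-\frac{\alpha_4}{y}$. Then the system coincides with the $D_4^{(1)}$ system (defined in the context) with these $\eta,\alpha_0,\dots,\alpha_4$ and some $b(t)\in\mathbb{C}(t)$.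
   Context: Condition (A2) means: for each $i$, when the system is rewritten in the coordinates $(x_i,y_i,z_i)$, the expressions for $dx_i/dt,dy_i/dt,dz_i/dt$ are polynomials in $x_i,y_i,z_i$ (with coefficients in $\mathbb{C}(t)$). The $D_4^{(1)}$ system. Let $\eta\in\mathbb{C}\setminus\{0\}$, let $b(t)\in\mathbb{C}(t)$ be nonzero, and let $\alpha_0,\dots,\alpha_4\in\mathbb{C}$ satisfy $\alpha_0+\alpha_1+2\alpha_2+\alpha_3+\alpha_4=1$. The $D_4^{(1)}$ system for unknown functions $x,y,z$ of $t$ is $$\frac{2\eta}{b(t)}\frac{dx}{dt}=P,\qquad -\frac{2\eta}{b(t)}\frac{dy}{dt}=Q,\qquad \frac{2\eta}{b(t)}\frac{dz}{dt}=R,$$ where $P=-2x(y-1)yz(x-\eta)(2x-2y+1-\eta)-2(2\alpha_0+2\alpha_1+4\alpha_2+\alpha_3+\alpha_4)x^3y-2(\alpha_0+\alpha_1)xy^3+(5\alpha_0+5\alpha_1+6\alpha_2+\alpha_3+\alpha_4)x^2y^2-\{5\alpha_0+5\alpha_1+6\alpha_2+2\alpha_3-3(2\alpha_0+2\alpha_1+4\alpha_2+\alpha_3+\alpha_4)\eta\}x^2y+\{3(\alpha_0+\alpha_1)-(4\alpha_0+6\alpha_1+6\alpha_2+\alpha_3+\alpha_4)\eta\}xy^2+x^4+2(\alpha_0+\alpha_1+2\alpha_2+\alpha_3-\eta)x^3+2\alpha_1\eta y^3+\{(\alpha_0+\alpha_1+2\alpha_2+\alpha_3)(\eta^2-3\eta+1)+\alpha_4\eta^2\}x^2+\alpha_1(\eta-3)\eta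 y^2+\{-(\alpha_0+\alpha_1)+2(2\alpha_0+3\alpha_1+3\alpha_2+\alpha_3)\eta-(2\alpha_0+2\alpha_1+4\alpha_2+\alpha_3+\alpha_4)\eta^2\}xy+(\alpha_0+\alpha_1+2\alpha_2+\alpha_3)(\eta-1)\eta x-\alpha_1(\eta-1)\eta y$, $Q=2x(y-1)yz(x-\eta)(2x-2y+1-\eta)-2(\alpha_3+\alpha_4)x^3y-2(\alpha_0+\alpha_1+4\alpha_2+2\alpha_3+2\alpha_4)xy^3+(\alpha_0+\alpha_1+6\alpha_2+5\alpha_3+5\alpha_4)x^2y^2+\{-(\alpha_0+\alpha_1+6\alpha_2+4\alpha_3+6\alpha_4)+3(\alpha_3+\alpha_4)\eta\}x^2y+\{3(\alpha_0+\alpha_1+4\alpha_2+2\alpha_3+2\alpha_4)-(2\alpha_0+6\alpha_2+5\alpha_3+5\alpha_4)\eta\}xy^2+y^4+2\alpha_4x^3+2\{(\alpha_0+2\alpha_2+\alpha_3+\alpha_4)\eta-1\}y^3-\alpha_4(3\eta-1)x^2+\{1-3(\alpha_0+2\alpha_2+\alpha_3+\alpha_4)\eta+(\alpha_0+2\alpha_2+\alpha_3+\alpha_4)\eta^2\}y^2+\{-(\alpha_0+\alpha_1+4\alpha_2+2\alpha_3+2\alpha_4)+2(\alpha_0+3\alpha_2+2\alpha_3+3\alpha_4)\eta-(\alpha_3+\alpha_4)\eta^2\}xy+\alpha_4(\eta-1)\eta x-(\alpha_0+2\alpha_2+\alpha_3+\alpha_4)(\eta-1)\eta y$, $R=(2x-2y+1-\eta)\{2x^2y+2xy^2-x^2-\eta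 y^2-2(\eta+1)xy+\eta(x+y)\}z^2+z\big[-2(\alpha_3+\alpha_4)x^3+2(\alpha_0+\alpha_1)y^3+2(\alpha_0+\alpha_1+6\alpha_2+2\alpha_3+2\alpha_4)x^2y-2(2\alpha_0+2\alpha_1+6\alpha_2+\alpha_3+\alpha_4)xy^2+\{-(\alpha_0+\alpha_1+6\alpha_2+4\alpha_3)+3(\alpha_3+\alpha_4)\eta\}x^2+\{-3(\alpha_0+\alpha_1)+(4\alpha_0+6\alpha_2+\alpha_3+\alpha_4)\eta\}y^2-4\{-(\alpha_0+\alpha_1+3\alpha_2+\alpha_3)+(\alpha_0+3\alpha_2+\alpha_3+\alpha_4)\eta\}xy+\{-(\alpha_0+\alpha_1+4\alpha_2+2\alpha_3)+2(\alpha_0+3\alpha_2+2\alpha_3)\eta-(\alpha_3+\alpha_4)\eta^2\}x+\{\alpha_0+\alpha_1-2(2\alpha_0+3\alpha_2+\alpha_3)\eta+(2\alpha_0+4\alpha_2+\alpha_3+\alpha_4)\eta^2\}y-(\alpha_0+2\alpha_2+\alpha_3)(\eta-1)\eta\big]+\alpha_2\big[(\alpha_0+\alpha_1+2\alpha_2-\alpha_3-\alpha_4)x^2+(\alpha_0+\alpha_1-2\alpha_2-\alpha_3-\alpha_4)y^2-2(\alpha_0+\alpha_1-\alpha_3-\alpha_4)xy+\{\alpha_0+\alpha_1-2\alpha_3-(2\alpha_0+2\alpha_2-\alpha_3-\alpha_4)\eta\}x+\{-\alpha_0-\alpha_1+2\alpha_2+2\alpha_3+(2\alpha_0-\alpha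_3-\alpha_4)\eta\}y+(\eta-1)(\alpha_2+\alpha_3+(\alpha_0+\alpha_2)\eta)\big]$.
   Formalization: The formal theorem also assumes η ≠ 1, η ≠ −1 and α_0,…,α_4 all nonzero; without any one of these the claim fails (e.g. if α_2 = 0, adding 1 to dz/dt of a D_4^{(1)} system keeps (A1) and (A2) but it is no longer such a system). *)

(* Defs.v *)
From HB Require Import structures.
From mathcomp Require Import all_boot all_order all_algebra.
From mathcomp Require Import fraction complex reals mpoly.
From mathcomp Require Import ring.

Set Implicit Arguments.
Unset Strict Implicit.
Unset Printing Implicit Defensive.

Import GRing.Theory.
Local Open Scope ring_scope.
Local Open Scope quotient_scope.

Notation "x %:F" := (tofrac x) : ring_scope.

(* C(t), with C = R[i] the complex numbers over the reals R. *)
Notation Ct R := {fraction {poly R[i]}}.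

(* C(t)[x, y, z] and C(t)(x, y, z); x, y, z are the variables 0, 1, 2. *)
Notation Ctxyz R := {mpoly Ct R[3]}.
Notation fracCtxyz R := {fraction Ctxyz R}.

Definition var_x : 'I_3 := @Ordinal 3 0 isT.
Definition var_y : 'I_3 := @Ordinal 3 1 isT.
Definition var_z : 'I_3 := @Ordinal 3 2 isT.

(* The quotient rule, extending a derivation [d] of [A] to its fraction field.
   [repr] picks one way of writing [q] as n / m; by [fracderE] the value does
   not depend on it. *)
Definition fracder (A : idomainType) (d : A -> A) (q : {fraction A}) :
    {fraction A} :=
  let: (n, m) := frac (repr q) in (d n * m - n * d m)%:F / (m ^+ 2)%:F.

Lemma fracderE (A : idomainType) (d : A -> A)
    (dM : forall u v, d (u * v) = d u * v + u * d v) (n m : A) :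
  m != 0 -> fracder d (n%:F / m%:F) = (d n * m - n * d m)%:F / (m ^+ 2)%:F.
Proof.
move=> m0; rewrite /fracder.
set q := _ / _.
have Hq : q = (frac (repr q)).1%:F / (frac (repr q)).2%:F.
  rewrite -{1}[q]reprK; case: (repr q) => [[n' m'] /= m'0].
  have h : m'%:F != 0 by rewrite tofrac_eq0.
  apply: (mulIf h); rewrite divfK //.
  rewrite /tofrac; unlock FracField.tofrac; rewrite -[LHS]pi_mul.
  apply/eqP; rewrite piE /= FracField.equivfE /FracField.mulf.
  rewrite !numden_Ratio ?oner_eq0 ?mulf_neq0 ?oner_eq0 //=.
  by rewrite ?mulr1 ?mul1r mulrC.
have := denom_ratioP (repr q).
case E : (frac (repr q)) Hq => [n' m'] /= Hq m'0.
have e : n' * m = n * m'.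
  have h : m%:F != 0 by rewrite tofrac_eq0.
  have h' : m'%:F != 0 by rewrite tofrac_eq0.
  apply/eqP; rewrite -(@tofrac_eq A) !tofracM -eqr_div //. by rewrite -Hq /q.
have ed : d n' * m + n' * d m = d n * m' + n * d m' by rewrite -!dM e.
apply/eqP; rewrite eqr_div ?tofrac_eq0 ?expf_neq0 // -!tofracM tofrac_eq.
apply/eqP.
have H : n' * m - n * m' = 0 by rewrite e subrr.
have H2 : d n' * m + n' * d m - (d n * m' + n * d m') = 0 by rewrite ed subrr.
apply/eqP; rewrite -subr_eq0; apply/eqP.
have -> : (d n' * m' - n' * d m') * m ^+ 2 - (d n * m - n * d m) * m' ^+ 2
    = m * m' * (d n' * m + n' * d m - (d n * m' + n * d m'))
      - (n' * m - n * m') * (d m' * m + d m * m') by ring.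
by rewrite H H2; ring.
Qed.

Definition ddt (R : realType) : Ct R -> Ct R := fracder (@deriv R[i]).

(* d/dt along the system dx/dt = f_0, dy/dt = f_1, dz/dt = f_2, by the chain
   rule; the first term differentiates the coefficients. *)
Definition total_der (R : realType) (f : 3.-tuple (Ctxyz R)) (p : Ctxyz R) :
    Ctxyz R :=
  map_mpoly (@ddt R) p + \sum_(j < 3) tnth f j * mderiv j p.

Definition frac_total_der (R : realType) (f : 3.-tuple (Ctxyz R)) :
    fracCtxyz R -> fracCtxyz R :=
  fracder (total_der f).

(* Rewritten in the coordinates c_0, c_1, c_2, the right-hand sides of the
   system are polynomials: each dc_j/dt is g(c_0, c_1, c_2) for some
   polynomial g over C(t). *)
Definition polynomial_in_coordinates (R : realType) (f : 3.-tuple (Ctxyz R))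
    (c : 3.-tuple (fracCtxyz R)) : Prop :=
  forall j : 'I_3, exists g : Ctxyz R,
    frac_total_der f (tnth c j) = mmap (fun k => (k%:MP)%:F) (tnth c) g.

(* The complex constant [c], seen in C(t) and in C(t)[x, y, z]. *)
Definition constt (R : realType) (c : R[i]) : Ct R := (c%:P)%:F.
Definition constp (R : realType) (c : R[i]) : Ctxyz R := (constt c)%:MP.

Definition coordinates (R : realType) (eta a0 a1 a2 a3 a4 : R[i]) :
    5.-tuple (3.-tuple (fracCtxyz R)) :=
  let x : fracCtxyz R := ('X_var_x)%:F in
  let y : fracCtxyz R := ('X_var_y)%:F in
  let z : fracCtxyz R := ('X_var_z)%:F in
  let c k : fracCtxyz R := (constp k)%:F in
  [tuple [tuple x - c eta; y; z - c a0 / (x - c eta)];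
         [tuple x; y; z - c a1 / x];
         [tuple x + c a2 / z; y + c a2 / z; z];
         [tuple x; y - 1; z - c a3 / (y - 1)];
         [tuple x; y; z - c a4 / y]].

(* The polynomials P, Q, R of the D_4^(1) system; e is eta. *)
Definition D4_P (A : comNzRingType) (e a0 a1 a2 a3 a4 x y z : A) : A :=
  - 2 * x * (y - 1) * y * z * (x - e) * (2 * x - 2 * y + 1 - e)
  - 2 * (2 * a0 + 2 * a1 + 4 * a2 + a3 + a4) * x ^+ 3 * y
  - 2 * (a0 + a1) * x * y ^+ 3
  + (5 * a0 + 5 * a1 + 6 * a2 + a3 + a4) * x ^+ 2 * y ^+ 2
  - (5 * a0 + 5 * a1 + 6 * a2 + 2 * a3
     - 3 * (2 * a0 + 2 * a1 + 4 * a2 + a3 + a4) * e) * x ^+ 2 * y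
  + (3 * (a0 + a1) - (4 * a0 + 6 * a1 + 6 * a2 + a3 + a4) * e) * x * y ^+ 2
  + x ^+ 4
  + 2 * (a0 + a1 + 2 * a2 + a3 - e) * x ^+ 3
  + 2 * a1 * e * y ^+ 3
  + ((a0 + a1 + 2 * a2 + a3) * (e ^+ 2 - 3 * e + 1) + a4 * e ^+ 2) * x ^+ 2
  + a1 * (e - 3) * e * y ^+ 2
  + (- (a0 + a1) + 2 * (2 * a0 + 3 * a1 + 3 * a2 + a3) * e
     - (2 * a0 + 2 * a1 + 4 * a2 + a3 + a4) * e ^+ 2) * x * y
  + (a0 + a1 + 2 * a2 + a3) * (e - 1) * e * x
  - a1 * (e - 1) * e * y.

Definition D4_Q (A : comNzRingType) (e a0 a1 a2 a3 a4 x y z : A) : A :=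
  2 * x * (y - 1) * y * z * (x - e) * (2 * x - 2 * y + 1 - e)
  - 2 * (a3 + a4) * x ^+ 3 * y
  - 2 * (a0 + a1 + 4 * a2 + 2 * a3 + 2 * a4) * x * y ^+ 3
  + (a0 + a1 + 6 * a2 + 5 * a3 + 5 * a4) * x ^+ 2 * y ^+ 2
  + (- (a0 + a1 + 6 * a2 + 4 * a3 + 6 * a4) + 3 * (a3 + a4) * e) * x ^+ 2 * y
  + (3 * (a0 + a1 + 4 * a2 + 2 * a3 + 2 * a4)
     - (2 * a0 + 6 * a2 + 5 * a3 + 5 * a4) * e) * x * y ^+ 2
  + y ^+ 4
  + 2 * a4 * x ^+ 3
  + 2 * ((a0 + 2 * a2 + a3 + a4) * e - 1) * y ^+ 3
  - a4 * (3 * e - 1) * x ^+ 2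
  + (1 - 3 * (a0 + 2 * a2 + a3 + a4) * e
     + (a0 + 2 * a2 + a3 + a4) * e ^+ 2) * y ^+ 2
  + (- (a0 + a1 + 4 * a2 + 2 * a3 + 2 * a4)
     + 2 * (a0 + 3 * a2 + 2 * a3 + 3 * a4) * e
     - (a3 + a4) * e ^+ 2) * x * y
  + a4 * (e - 1) * e * x
  - (a0 + 2 * a2 + a3 + a4) * (e - 1) * e * y.

Definition D4_R (A : comNzRingType) (e a0 a1 a2 a3 a4 x y z : A) : A :=
  (2 * x - 2 * y + 1 - e)
    * (2 * x ^+ 2 * y + 2 * x * y ^+ 2 - x ^+ 2 - e * y ^+ 2
       - 2 * (e + 1) * x * y + e * (x + y)) * z ^+ 2
  + z * (- 2 * (a3 + a4) * x ^+ 3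
         + 2 * (a0 + a1) * y ^+ 3
         + 2 * (a0 + a1 + 6 * a2 + 2 * a3 + 2 * a4) * x ^+ 2 * y
         - 2 * (2 * a0 + 2 * a1 + 6 * a2 + a3 + a4) * x * y ^+ 2
         + (- (a0 + a1 + 6 * a2 + 4 * a3) + 3 * (a3 + a4) * e) * x ^+ 2
         + (- 3 * (a0 + a1) + (4 * a0 + 6 * a2 + a3 + a4) * e) * y ^+ 2
         - 4 * (- (a0 + a1 + 3 * a2 + a3) + (a0 + 3 * a2 + a3 + a4) * e)
             * x * y
         + (- (a0 + a1 + 4 * a2 + 2 * a3)
            + 2 * (a0 + 3 * a2 + 2 * a3) * e - (a3 + a4) * e ^+ 2) * x
         + (a0 + a1 - 2 * (2 * a0 + 3 * a2 + a3) * e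
            + (2 * a0 + 4 * a2 + a3 + a4) * e ^+ 2) * y
         - (a0 + 2 * a2 + a3) * (e - 1) * e)
  + a2 * ((a0 + a1 + 2 * a2 - a3 - a4) * x ^+ 2
          + (a0 + a1 - 2 * a2 - a3 - a4) * y ^+ 2
          - 2 * (a0 + a1 - a3 - a4) * x * y
          + (a0 + a1 - 2 * a3 - (2 * a0 + 2 * a2 - a3 - a4) * e) * x
          + (- a0 - a1 + 2 * a2 + 2 * a3 + (2 * a0 - a3 - a4) * e) * y
          + (e - 1) * (a2 + a3 + (a0 + a2) * e)).

(* dx/dt = f_0, dy/dt = f_1, dz/dt = f_2 is the D_4^(1) system with parameters
   eta, a0, ..., a4 and b. *)
Definition is_D4_system (R : realType) (eta a0 a1 a2 a3 a4 : R[i]) (b : Ct R)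
    (f : 3.-tuple (Ctxyz R)) : Prop :=
  let at_xyz (F : Ctxyz R -> Ctxyz R -> Ctxyz R -> Ctxyz R -> Ctxyz R ->
                  Ctxyz R -> Ctxyz R -> Ctxyz R -> Ctxyz R -> Ctxyz R) :=
    F (constp eta) (constp a0) (constp a1) (constp a2) (constp a3) (constp a4)
      'X_var_x 'X_var_y 'X_var_z in
  let s : Ct R := 2 * constt eta / b in
  [/\ b != 0,
      s *: tnth f var_x = at_xyz (@D4_P _),
      - s *: tnth f var_y = at_xyz (@D4_Q _)
    & s *: tnth f var_z = at_xyz (@D4_R _)].

(* Main.v *)
Require Import Defs.
From HB Require Import structures.
From mathcomp Require Import all_boot all_order all_algebra.
From mathcomp Require Import fraction complex reals mpoly.
From mathcomp Require Import polyXY ring zify.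

Set Implicit Arguments.
Unset Strict Implicit.
Unset Printing Implicit Defensive.

Import GRing.Theory.
Local Open Scope ring_scope.

(** The whole argument takes place on the fibres of q = x - y.  Every chart
    respects q: the charts 0, 1, 3, 4 only change z, and chart 2 moves x and y by
    the same amount.  With y = x - q the right-hand sides become polynomials
    f, g, p in x and z over the field M = C(t)(q), and the charts become
    substitutions in two variables: z + a/(x - r) for z, with r = eta, 0, q + 1
    and q for a = a0, a1, a3, a4, and x - a2/z for x.  Being polynomial in a
    chart means that no pole is created by the substitution.

    Charts 0, 1, 3, 4.  If z^k is the top power of z, k > 0, the coefficient of
    z^(k-1) after substitution has the residue k a u(r) at r, where u is the
    coefficient of z^k (root_lead_shift).  So u has the four roots 0, eta, q,
    q + 1, while its degree in x is at most 6 - k.  This, with a closer look at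
    the z^2-terms (z2_double_root), leaves f = A + B z, g = C + D z and
    p = E0 + E1 z + E2 z^2, where B and D have the four roots.  At the roots
    belonging to f it also gives 2 E2 + B' = 0 and A = a E2, and likewise with
    C and D for g (root_relations).

    Chart 2.  Give x weight -1 and z weight 1, so that s = x z has weight 0.
    The part of weight -n of a polynomial in x and z is x^n h(s), and it creates
    no pole exactly when (s + a2)^n divides s^n h(s) (dvdp_weight).  Since the
    degree in z is small, h has degree at most 3, and this is very restrictive
    (laurent_P, laurent_diff): D = B = b x (x - eta) (x - q) (x - q - 1) with b in
    M, the difference A - C lies in M, and E0, E1 and the cubic terms of A and
    E2 are determined by b and the other coefficients of A and E2.

    The relations at the roots now determine E2 from b, and the coefficients of
    A up to the division by w = 2 q + 1 - eta that occurs in solving for the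
    coefficient of x^2.  Hence the system is a multiple c of the D_4^(1) system
    with c in M (fibre_D4).  Here c w and c v are polynomials in q, v being the
    coefficient of x^2 in P.  At the root of w the normalisation of
    a0, ..., a4 turns v into (1 - eta^2)/4, which is not zero; so c is a
    polynomial in q, and as c w comes from a coefficient of x^4 z in a polynomial
    of total degree 6, c does not involve q at all (multiplier_const).

    It remains to pass from the derivatives of the chart coordinates, which are
    fractions, to these substitutions.  A ring morphism eps defined on
    polynomials extends to the fractions whose denominator it makes invertible;
    the relation specializes is this partial extension.  Applied to the
    substitution of a chart, it sends the chart coordinates to polynomials
    (chart_pole, chart_infty). *)

(** * Substituting z + s for z *)

Lemma coef_comp_XaddC (R : comNzRingType) (c : R) (p : {poly R}) N j :
  (size p <= N)%N ->
  (p \Po ('X + c%:P))`_j = \sum_(k < N) p`_k * c ^+ (k - j) *+ 'C(k, j).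
Proof.
move=> sp; rewrite coef_comp_poly.
rewrite (big_ord_widen N (fun k => p`_k * (('X + c%:P) ^+ k)`_j)) //.
rewrite big_mkcond; apply: eq_bigr => k _; case: ifP => [_|/negbT].
  rewrite -mulrnAr; congr (_ * _).
  rewrite addrC exprDn coef_sum.
  have [lejk|ltkj] := leqP j k.
    have lj : (j < k.+1)%N by rewrite ltnS.
    rewrite (bigD1 (Ordinal lj)) //= big1 ?addr0 => [|i].
      by rewrite -polyC_exp coefMn coefCM coefXn eqxx mulr1.
    rewrite -val_eqE /= => ij.
    by rewrite -polyC_exp coefMn coefCM coefXn eq_sym (negbTE ij) mulr0 mul0rn.
  rewrite bin_small // mulr0n big1 // => i _.
  rewrite -polyC_exp coefMn coefCM coefXn.
  case: eqP => [e|_]; last by rewrite mulr0 mul0rn.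
  by move: (ltn_ord i); rewrite -e ltnS leqNgt ltkj.
by rewrite -leqNgt => le; rewrite (nth_default 0 le) mul0r mul0rn.
Qed.

HB.lock Definition shift (S : idomainType) (s : {fraction S}) (p : {poly S}) :
    {poly {fraction S}} :=
  map_poly (@tofrac S) p \Po ('X + s%:P).

Lemma coef_shift (S : idomainType) (s : {fraction S}) (p : {poly S}) N j :
  (size p <= N)%N ->
  (shift s p)`_j = \sum_(k < N) (p`_k)%:F * s ^+ (k - j) *+ 'C(k, j).
Proof.
move=> sp; rewrite unlock (@coef_comp_XaddC _ _ _ N).
  by apply: eq_bigr => k _; rewrite coef_map.
by apply: leq_trans sp; rewrite size_poly.
Qed.

Definition pole (M : fieldType) (a r : M) : {fraction {poly M}} :=
  a%:P%:F / ('X - r%:P)%:F.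

(** The coefficient of z^k in p(z + a/(x - r)) is p_k + (k+1) p_(k+1) a/(x - r)
    when p has degree at most k + 1 in z. *)
Lemma root_lead_shift (M : fieldType) (M0 : [pchar M] =i pred0)
    (a r : M) (p : {poly {poly M}}) (k : nat) (g : {poly M}) :
  a != 0 -> (size p <= k.+2)%N ->
  (shift (pole a r) p)`_k = g%:F -> root p`_k.+1 r.
Proof.
move=> a0 sp; rewrite /pole (coef_shift _ _ sp) !big_ord_recr /= big1 ?add0r;
  last first.
  by move=> i _; rewrite bin_small ?mulr0n //.
rewrite subnn subSnn expr0 mulr1 expr1 binn mulr1n binSn.
have d0 : ('X - r%:P)%:F != 0 :> {fraction {poly M}} by rewrite tofrac_eq0 polyXsubC_eq0.
move/(congr1 (fun u => u * ('X - r%:P)%:F)); rewrite mulrDl mulrnAl mulrA divfK //.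
rewrite -!tofracM -tofracMn -tofracD => /eqP; rewrite tofrac_eq => /eqP.
move/(congr1 (horner^~ r)); rewrite !hornerE subrr !mulr0 add0r hornerMn hornerE.
rewrite -mulr_natr => /eqP; rewrite hornerE !mulf_eq0 (negbTE a0) orbF.
have /pcharf0P -> := M0; by rewrite orbF.
Qed.

(** * The charts shifting z by a/(x - r) *)

Lemma all_roots_eq0 (M : fieldType) (rs : seq M) (p : {poly M}) :
  uniq rs -> {in rs, forall r, root p r} -> (size p <= size rs)%N -> p = 0.
Proof.
move=> u h sp; apply: (@roots_geq_poly_eq0 _ p rs) => //.
by apply/allP => r /h.
Qed.

(** The bound 7 - k on the sizes of the coefficients is the total degree 6.  For
    k > 2 a coefficient of z^k has at least as many roots as its size. *)
Lemma size_shift (M : fieldType) (M0 : [pchar M] =i pred0)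
    (cs : seq (M * M)) (p : {poly {poly M}}) m :
  uniq [seq c.2 | c <- cs] -> size cs = 4%N ->
  {in cs, forall c, c.1 != 0} ->
  (size p <= 7)%N -> (forall k, (size (p`_k)%R <= 7 - k)%N) -> (2 <= m)%N ->
  {in cs, forall c, forall j, (m <= j)%N ->
     exists g : {poly M}, (shift (pole c.1 c.2) p)`_j = g%:F} ->
  (size p <= m.+1)%N.
Proof.
move=> u s4 c0 sp sk m2 H.
suff hn n : (size p <= n + m.+1)%N -> (size p <= m.+1)%N.
  by apply: (hn 7); apply: leq_trans sp _; rewrite leq_addr.
elim: n => // n IH; rewrite addSn => sn; apply: IH.
suff e : p`_(n + m).+1 = 0.
  apply/leq_sizeP => j; rewrite leq_eqVlt => /predU1P[<-|lt]; first by rewrite addnS.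
  by move/leq_sizeP: sn; apply.
apply: (all_roots_eq0 u).
  move=> _ /mapP[c cc ->]; have [|g hg] := H c cc (n + m)%N; first exact: leq_addl.
  by apply: (root_lead_shift M0 (c0 _ cc) _ hg); rewrite -addnS.
rewrite size_map s4; apply: leq_trans (sk _) _.
by rewrite leq_subLR addSnnS (@leq_add 2 5) // (leq_trans m2) ?leq_addl.
Qed.

Lemma coef_shift4 (S : idomainType) (s : {fraction S}) (p : {poly S}) :
  (size p <= 4)%N ->
  [/\ (shift s p)`_0 = (p`_0)%:F + (p`_1)%:F * s + (p`_2)%:F * s ^+ 2
                       + (p`_3)%:F * s ^+ 3,
      (shift s p)`_1 = (p`_1)%:F + 2 * (p`_2)%:F * s + 3 * (p`_3)%:F * s ^+ 2 &
      (shift s p)`_2 = (p`_2)%:F + 3 * (p`_3)%:F * s].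
Proof.
move=> sp; split; rewrite (coef_shift _ _ sp) !big_ord_recr big_ord0 /=.
- rewrite !bin0 !mulr1n; ring.
- rewrite !bin1; ring.
- have -> : 'C(3,2) = 3%N by []. rewrite !binn !bin_small //; ring.
Qed.

Section ClearDenominators.
Variables (L : fieldType) (A D p0 p1 p2 p3 g0 g1 u h : L).
Hypothesis D0 : D != 0.

(* With p of degree 3 and g of degree 2 in z, and u D the coefficient of z^2 in
   g, these are the coefficients of z^2, z and 1 in
   p(z + A/D) + (A/D^2) g(z + A/D). *)
Lemma clear2 :
  p2 + 3 * p3 * (A / D) + A / D ^+ 2 * (u * D + 3 * 0 * (A / D)) = h ->
  A * (3 * p3 + u) = (h - p2) * D.
Proof. by move=> <-; field. Qed.

Lemma clear1 :
  p1 + 2 * p2 * (A / D) + 3 * p3 * (A / D) ^+ 2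
    + A / D ^+ 2 * (g1 + 2 * (u * D) * (A / D) + 3 * 0 * (A / D) ^+ 2) = h ->
  A * (A * (3 * p3 + 2 * u) + g1) = (h * D - p1 * D - 2 * A * p2) * D.
Proof. by move=> <-; field. Qed.

Lemma clear0 :
  p0 + p1 * (A / D) + p2 * (A / D) ^+ 2 + p3 * (A / D) ^+ 3
    + A / D ^+ 2 * (g0 + g1 * (A / D) + u * D * (A / D) ^+ 2
                    + 0 * (A / D) ^+ 3) = h ->
  A ^+ 2 * (A * (p3 + u) + g1)
    = (h * D ^+ 2 - p0 * D ^+ 2 - A * p1 * D - A ^+ 2 * p2 - A * g0) * D.
Proof. by move=> <-; field. Qed.

(* The same coefficients of z and 1 for p of degree 2 and g of degree 1 in z. *)
Lemma clear1' :
  p1 + 2 * p2 * (A / D) + 3 * 0 * (A / D) ^+ 2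
    + A / D ^+ 2 * (u * D + 2 * 0 * (A / D) + 3 * 0 * (A / D) ^+ 2) = h ->
  A * (2 * p2 + u) = (h - p1) * D.
Proof. by move=> <-; field. Qed.

Lemma clear0' :
  p0 + p1 * (A / D) + p2 * (A / D) ^+ 2 + 0 * (A / D) ^+ 3
    + A / D ^+ 2 * (g0 + u * D * (A / D) + 0 * (A / D) ^+ 2
                    + 0 * (A / D) ^+ 3) = h ->
  A * (A * (p2 + u) + g0) = (h * D - p0 * D - A * p1) * D.
Proof. by move=> <-; field. Qed.
End ClearDenominators.

(** In the chart z' = z - a/d with d = x - r, the derivative of z' is that of z
    plus (a/d^2) times that of d; here p and g stand for the derivatives of z
    and d. *)
Section AtRoot.
Variables (M : fieldType) (M0 : [pchar M] =i pred0) (a r : M).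
Hypothesis (a0 : a != 0).
Variables (p g : {poly {poly M}}).
Let d : {poly M} := 'X - r%:P.
Hypothesis H : forall j, exists h : {poly M},
  (shift (pole a r) p + (a%:P%:F / d%:F ^+ 2)%:P * shift (pole a r) g)`_j = h%:F.

Let dn0 : d%:F != 0 :> {fraction {poly M}}.
Proof. by rewrite tofrac_eq0 polyXsubC_eq0. Qed.

Let toroot (u v : {poly M}) : u%:F = (v * d)%:F -> u.[r] = 0.
Proof.
move/eqP; rewrite tofrac_eq => /eqP ->.
by rewrite hornerM /d !hornerE subrr mulr0.
Qed.

(** At x = r the poles of the coefficients of z^2, z and 1 give, with e the value
    of the coefficient of z^3 in p and g1 that of z in g, the equations
    3 e + u = 0, a (3 e + 2 u) + g1 = 0 and a (e + u) + g1 = 0. *)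
Lemma z2_double_root (u : {poly M}) :
  (size g <= 3)%N -> (size p <= 4)%N -> g`_2 = u * d -> root u r /\ root p`_3 r.
Proof.
move=> sg sp e.
have [p0 p1 p2] := coef_shift4 (pole a r) sp.
have [g0 g1 g2] := coef_shift4 (pole a r) (leq_trans sg (leqnSn _)).
have g3 : g`_3 = 0 by rewrite nth_default.
have [h0] := H 0; have [h1] := H 1; have [h2] := H 2.
rewrite !coefD !coefCM p0 p1 p2 g0 g1 g2 g3 e tofrac0 !tofracM /pole -/d; clearbody d.
set A := a%:P%:F; set D := d%:F => E2 E1 E0.
have R2 : 3 * (p`_3).[r] + u.[r] = 0.
  have : (a%:P * (3%:R * p`_3 + u))%:F = ((h2 - p`_2) * d)%:F.
    rewrite !(tofracM, tofracD, tofracN, tofracMn, tofrac1); exact: (clear2 dn0 E2).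
  move/toroot; rewrite !(hornerM, hornerD, hornerMn, hornerC) => /eqP.
  by rewrite mulf_eq0 (negbTE a0) /= => /eqP.
have R1 : a * (3 * (p`_3).[r] + 2 * u.[r]) + (g`_1).[r] = 0.
  have : (a%:P * (a%:P * (3%:R * p`_3 + 2%:R * u) + g`_1))%:F
       = ((h1 * d - p`_1 * d - 2%:R * a%:P * p`_2) * d)%:F.
    rewrite !(tofracM, tofracD, tofracN, tofracMn, tofrac1); exact: (clear1 dn0 E1).
  move/toroot; rewrite !(hornerM, hornerD, hornerMn, hornerC) => /eqP.
  by rewrite mulf_eq0 (negbTE a0) /= => /eqP.
have R0 : a * ((p`_3).[r] + u.[r]) + (g`_1).[r] = 0.
  have : (a%:P ^+ 2 * (a%:P * (p`_3 + u) + g`_1))%:F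
       = ((h0 * d ^+ 2 - p`_0 * d ^+ 2 - a%:P * p`_1 * d - a%:P ^+ 2 * p`_2
         - a%:P * g`_0) * d)%:F.
    rewrite !(tofracM, tofracD, tofracN, tofracMn, tofrac1, tofracXn);
      exact: (clear0 dn0 E0).
  move/toroot; rewrite !hornerE => /eqP.
  by rewrite !mulf_eq0 ?expf_eq0 (negbTE a0) /= => /eqP.
have S : (p`_3).[r] = 0.
  apply: (mulfI a0); rewrite mulr0.
  have -> : a * (p`_3).[r] = a * (3 * (p`_3).[r] + u.[r])
    - (a * (3 * (p`_3).[r] + 2 * u.[r]) + (g`_1).[r]) + (a * ((p`_3).[r] + u.[r])
      + (g`_1).[r]) by ring.
  by rewrite R2 R1 R0 mulr0 subrr add0r.
by split; apply/eqP => //; move: R2; rewrite S mulr0 add0r.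
Qed.

(** The poles of the coefficients of z and 1: 2 E2 + b and a (E2 + b) + g0 vanish
    at r. *)
Lemma root_relations (b : {poly M}) :
  (size g <= 2)%N -> (size p <= 3)%N -> g`_1 = b * d ->
  2 * (p`_2).[r] + b.[r] = 0 /\ (g`_0).[r] = a * (p`_2).[r].
Proof.
move=> sg sp e.
have [p0 p1 _] := coef_shift4 (pole a r) (leq_trans sp (leqnSn _)).
have [g0 g1 _] := coef_shift4 (pole a r) (leq_trans sg (isT : (2 <= 4)%N)).
have p3 : p`_3 = 0 by rewrite nth_default.
have g3 : g`_3 = 0 by rewrite nth_default // (leq_trans sg).
have g2 : g`_2 = 0 by rewrite nth_default // (leq_trans sg).
have [h0] := H 0; have [h1] := H 1.
rewrite !coefD !coefCM p0 p1 g0 g1 g3 g2 p3 e tofrac0 !tofracM /pole -/d; clearbody d.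
set A := a%:P%:F; set D := d%:F => E1 E0.
have R1 : 2 * (p`_2).[r] + b.[r] = 0.
  have : (a%:P * (2%:R * p`_2 + b))%:F
       = ((h1 - p`_1) * d)%:F.
    rewrite !(tofracM, tofracD, tofracN, tofracMn, tofrac1); exact: (clear1' dn0 E1).
  move/toroot; rewrite !(hornerM, hornerD, hornerMn, hornerC) => /eqP.
  by rewrite mulf_eq0 (negbTE a0) /= => /eqP.
split => //.
have : (a%:P * (a%:P * (p`_2 + b) + g`_0))%:F
       = ((h0 * d - p`_0 * d - a%:P * p`_1) * d)%:F.
  rewrite !(tofracM, tofracD, tofracN, tofracMn, tofrac1, tofracXn);
    exact: (clear0' dn0 E0).
move/toroot; rewrite !hornerE => /eqP.
rewrite !mulf_eq0 (negbTE a0) /= => /eqP R0.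
have -> : (g`_0).[r] = (a * ((p`_2).[r] + b.[r]) + (g`_0).[r])
  - a * (2 * (p`_2).[r] + b.[r]) + a * (p`_2).[r] by ring.
by rewrite R0 R1 mulr0 subrr add0r.
Qed.

End AtRoot.

(** * The chart translating x by a multiple of 1/z *)

Section Weight.
Variables (M : fieldType) (a : M).
Implicit Types p : {poly {poly M}}.

(** Here the outer variable is x and the inner one z.  This is the part of weight
    e - n, with x of weight -1 and z of weight 1, as a polynomial in s = x z: its
    term of degree k comes from x^k z^(k + e - n). *)
Definition weight_part N e n p : {poly M} :=
  \poly_(k < N) (if (n <= k + e)%N then p`_k`_(k + e - n) else 0).

(** Write w for the part of weight e - n.  Under x -> x + a/z it becomes
    z^(e-n) w(x z + a), in which the monomial x^j z^(e-n+j) has the coefficient of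
    s^j in w(s + a).  It must vanish for j < n, where the exponent of z is below
    e. *)
Lemma dvdp_weight N e n p :
  (size p <= N)%N ->
  (forall j, exists g : {poly M},
     (shift (a%:P%:F / 'X%:F) p)`_j = ('X^e * g)%:F) ->
  ('X - a%:P) ^+ n %| weight_part N e n p.
Proof.
move=> sp H; set T := weight_part N e n p.
have sT : (size T <= N)%N by apply: size_poly.
have X0 : ('X : {poly M})%:F != 0 :> {fraction {poly M}}.
  by rewrite tofrac_eq0 polyX_eq0.
suff h j : (j < n)%N -> (T \Po ('X + a%:P))`_j = 0.
  have e1 : T \Po ('X + a%:P) = drop_poly n (T \Po ('X + a%:P)) * 'X^n.
    rewrite -[LHS](poly_take_drop n) [X in X + _](_ : _ = 0) ?add0r //.
    by apply/polyP => j; rewrite coef_take_poly coef0; case: ifP => // /h.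
  rewrite -[T](comp_polyXaddC_K _ a) e1 comp_polyM comp_Xn_poly.
  exact: dvdp_mull.
move=> jn; rewrite (coef_comp_XaddC _ _ sT).
have [g] := H j; rewrite (coef_shift _ _ sp).
move/(congr1 (fun u => u * ('X^N)%:F)); rewrite mulr_suml.
have -> : \sum_(k < N) ((p`_k)%:F * (a%:P%:F / 'X%:F) ^+ (k - j) *+ 'C(k, j)) * ('X^N)%:F
  = (\sum_(k < N) a ^+ (k - j) *: (p`_k * 'X^(N - (k - j))) *+ 'C(k,j))%:F.
  rewrite rmorph_sum; apply: eq_bigr => k _.
  rewrite rmorphMn /= mulrnAl -mul_polyC; congr (_ *+ _).
  rewrite !tofracM polyC_exp !tofracXn expr_div_n.
  have kN : (k - j <= N)%N by have := ltn_ord k; lia.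
  rewrite -[in 'X%:F ^+ N](subnK kN) exprD.
  have aux (L : fieldType) (u v x y : L) :
    x != 0 -> u * (v / x) * (y * x) = v * (u * y) by move=> x0; field.
  by apply: aux; rewrite expf_neq0.
rewrite -tofracM => /eqP; rewrite tofrac_eq => /eqP.
have [leNe|ltNe] := leqP n (N + e); last first.
  move=> _; apply: big1 => k _; rewrite coef_poly ltn_ord.
  by rewrite ifF ?mul0r ?mul0rn //; have := ltn_ord k; lia.
move/(congr1 (fun u : {poly M} => u`_(N + e - n + j))).
rewrite mulrAC -exprD coefXnM.
have -> : (N + e - n + j < e + N)%N.
  by lia.
rewrite coef_sum => E; rewrite -[RHS]E; apply: eq_bigr => k _.
rewrite coefMn coefZ coefMXn coef_poly ltn_ord.
have [lejk|ltkj] := leqP j k; last by rewrite bin_small.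
congr (_ *+ _); rewrite mulrC; congr (_ * _).
have kN := ltn_ord k.
have -> : (N + e - n + j < N - (k - j))%N = ~~ (n <= k + e)%N by lia.
by case: ifP => // nk /=; congr (_`_ _); lia.
Qed.

Lemma dvdp_XsubC_small n D (q : {poly M}) :
  (size q <= D)%N -> (D <= n)%N -> ('X - a%:P) ^+ n %| q -> q = 0.
Proof.
move=> sq Dn /dvdp_leq h; apply/eqP; apply: contraT => /h.
by rewrite size_exp_XsubC => /leq_trans /(_ (leq_trans sq Dn)); rewrite ltnn.
Qed.

Lemma dvdp_XsubC_scale n (q : {poly M}) :
  (size q <= n.+1)%N -> ('X - a%:P) ^+ n %| q -> q = q`_n *: ('X - a%:P) ^+ n.
Proof.
move=> sq /dvdpP[r e].
have m : ('X - a%:P) ^+ n \is monic by apply: monic_exp; apply: monicXsubC.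
have [r0|r0] := eqVneq r 0; first by rewrite e r0 mul0r coef0 scale0r.
have sr : (size r <= 1)%N.
  move: sq; rewrite e size_Mmonic // size_exp_XsubC; lia.
rewrite e (size1_polyC sr) mul_polyC coefZ.
have -> : (('X - a%:P) ^+ n)`_n = 1; last by rewrite mulr1.
by move/monicP: m; rewrite lead_coefE size_exp_XsubC.
Qed.

Hypothesis a0 : a != 0.

(** For e <= n the part above is divisible by s^(n-e), and s is prime to s - a;
    the quotient has only D terms when p has z-degree less than D. *)
Lemma dvdp_weight_low N D e n p :
  (size p <= N)%N -> (forall k, (size (p`_k)%R <= D)%N) -> (e <= n)%N ->
  (forall j, exists g : {poly M},
     (shift (a%:P%:F / 'X%:F) p)`_j = ('X^e * g)%:F) ->
  ('X - a%:P) ^+ n %| \poly_(i < D) p`_(n - e + i)`_i.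
Proof.
move=> sp sD en /(dvdp_weight n sp).
have -> : weight_part N e n p = 'X^(n - e) * \poly_(i < D) p`_(n - e + i)`_i.
  apply/polyP => k; rewrite coefXnM !coef_poly.
  have -> : (k < n - e)%N = ~~ (n <= k + e)%N by lia.
  case: (leqP n (k + e)) => nk /=; last by rewrite if_same.
  have -> : (n - e + (k - (n - e)) = k)%N by lia.
  have -> : (k - (n - e) = k + e - n)%N by lia.
  have -> : (if (k < N)%N then p`_k`_(k + e - n) else 0) = p`_k`_(k + e - n).
    by case: ltnP => // le; rewrite (nth_default 0 (leq_trans sp le)) coef0.
  by case: ltnP => // le; rewrite (nth_default 0 (leq_trans (sD k) le)).
rewrite Gauss_dvdpr // coprimep_expl // coprimep_expr //.
by rewrite coprimep_sym coprimep_XsubC rootX.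
Qed.

End Weight.

(** In this section x is moved by c/z; the chart has c = - a2. *)
Section TranslationChart.
Variables (M : fieldType) (c : M).
Hypothesis c0 : c != 0.
Implicit Types f h p : {poly {poly M}}.

(** The factor z^e accounts for derivatives of coordinates that have been
    multiplied by z^e to clear their denominators. *)
Definition laurent_integral e p := forall j, exists g : {poly M},
  (shift (c%:P%:F / 'X%:F) p)`_j = ('X^e * g)%:F.

Section Bounds.
Variables (N D e : nat) (p : {poly {poly M}}).
Hypotheses (sp : (size p <= N)%N) (sD : forall k, (size (p`_k)%R <= D)%N).
Hypothesis (I : laurent_integral e p).

Lemma weight_high n i : (e <= n)%N -> (D <= n)%N -> p`_(n - e + i)`_i = 0.
Proof.
move=> en Dn; have [iD|Di] := ltnP i D; last first.
  by rewrite nth_default // (leq_trans (sD _)).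
have := dvdp_weight_low c0 sp sD en I.
move/(dvdp_XsubC_small (size_poly _ _) Dn) => /(congr1 (fun q : {poly M} => q`_i)).
by rewrite coef_poly iD coef0.
Qed.

Lemma weight_root n : (e <= n)%N -> (0 < n)%N ->
  \sum_(i < D) p`_(n - e + i)`_i * c ^+ i = 0.
Proof.
move=> en n0; have := dvdp_weight_low c0 sp sD en I.
rewrite -(prednK n0) exprSr => /(dvdp_trans (dvdp_mulIr _ _)).
rewrite dvdp_XsubCl => /rootP; rewrite (prednK n0).
by rewrite horner_poly.
Qed.

Lemma weight_root' n : (e <= n)%N -> (1 < n)%N ->
  \sum_(i < D) p`_(n - e + i)`_i * (c ^+ i.-1 *+ i) = 0.
Proof.
move=> en n1; have := dvdp_weight_low c0 sp sD en I.
case/dvdpP => r E.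
have : (\poly_(i < D) p`_(n - e + i)`_i)^`().[c] = 0.
  rewrite E derivM deriv_exp hornerD !hornerM derivXsubC hornerMn.
  case: n n1 {en E} => [|[|n]] // _.
  by rewrite /= mul1r !horner_exp hornerXsubC subrr !expr0n /= mul0rn !mulr0 addr0.
move=> E0; rewrite -[RHS]E0; rewrite poly_def raddf_sum horner_sum;
  apply: eq_bigr => i _ /=.
by rewrite derivZ derivXn hornerZ hornerMn hornerXn.
Qed.

End Bounds.

Lemma laurent_R h :
  (size h <= 7)%N -> (forall k, (size (h`_k)%R <= 3)%N) -> laurent_integral 0 h ->
  [/\ forall n, (3 <= n)%N -> [/\ h`_n`_0 = 0, h`_n.+1`_1 = 0 & h`_n.+2`_2 = 0],
      h`_2`_0 = c ^+ 2 * h`_4`_2 &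
      h`_1`_0 + c * h`_2`_1 + c ^+ 2 * h`_3`_2 = 0].
Proof.
move=> sh sD I; split.
- move=> n n3; have H i := weight_high sh sD I i (leq0n n) n3.
  by have := H 0; have := H 1; have := H 2; rewrite !subn0 addn0 addn1 addn2.
- have := weight_root' sh sD I (leq0n 2) isT.
  have := weight_root sh sD I (leq0n 2) isT.
  rewrite !big_ord_recr !big_ord0 /= !expr0 expr1 !mulr0n !mulr1n.
  move=> E1 E2.
  have -> : h`_2`_0 = (0 + h`_2`_0 * 1 + h`_3`_1 * c + h`_4`_2 * c ^+ 2) - c * (0
    + h`_2`_0 * 0 + h`_3`_1 * 1 + h`_4`_2 * (c *+ 2)) + c ^+ 2 * h`_4`_2 by ring.
  by rewrite E1 E2 mulr0 subrr add0r.
- have := weight_root sh sD I (leq0n 1) isT.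
  rewrite !big_ord_recr !big_ord0 /= => E0; rewrite -[RHS]E0; ring.
Qed.

Lemma laurent_diff p :
  (size p <= 7)%N -> (forall k, (size (p`_k)%R <= 2)%N) -> laurent_integral 0 p ->
  [/\ forall n, (2 <= n)%N -> p`_n`_0 = 0,
      forall n, (3 <= n)%N -> p`_n`_1 = 0 & p`_1`_0 + c * p`_2`_1 = 0].
Proof.
move=> sp sD I; split.
- by move=> n n2; have := weight_high sp sD I 0 (leq0n n) n2; rewrite subn0 addn0.
- case=> // n n2; have := weight_high sp sD I 1 (leq0n n) n2.
  by rewrite subn0 addn1.
- have := weight_root sp sD I (leq0n 1) isT.
  rewrite !big_ord_recr !big_ord0 /= => E0; rewrite -[RHS]E0; ring.
Qed.

(** The derivative of x - c/z is f + (c/z^2) p, whence the exponent 2.  Its parts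
    of weight n >= 4 are divisible by a power of s - c exceeding their degree 3 and
    vanish; the part for n = 3 is a multiple of (s - c)^3; those for n = 2 and
    n = 1 have a double and a simple root at c. *)
Lemma laurent_P f h :
  (size f <= 7)%N -> (forall k, (size (f`_k)%R <= 2)%N) ->
  (size h <= 7)%N -> (forall k, (size (h`_k)%R <= 3)%N) ->
  laurent_integral 0 h -> laurent_integral 2 ('X^2 *: f + c%:P *: h) ->
  let b := f`_4`_1 in
  [/\ [/\ forall n, (4 <= n)%N -> f`_n`_0 = 0, f`_3`_0 = - c * b & f`_5`_1 = 0],
      [/\ forall n, (4 <= n)%N -> h`_n`_2 = 0,
          forall n, (3 <= n)%N -> h`_n`_1 = 0 &
          forall n, (2 <= n)%N -> h`_n`_0 = 0],
      [/\ h`_1`_0 = - c ^+ 2 * b, h`_2`_1 = 3 * c * b & h`_3`_2 = - 2 * b] &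
      [/\ h`_1`_1 = - 2 * (f`_2`_0 + c * h`_2`_2) - 3 * c * f`_3`_1,
          h`_0`_0 = c * (f`_2`_0 + c * h`_2`_2) + 2 * c ^+ 2 * f`_3`_1 &
          h`_0`_1 = - (f`_1`_0 + c * h`_1`_2) - c * f`_2`_1]].
Proof.
move=> sf sfD sh shD Ih Ip b.
set p := _ + _ in Ip.
have [R1 R2 R3] := laurent_R sh shD Ih.
have cp k i : p`_k`_i = (if (i < 2)%N then 0 else f`_k`_(i - 2)) + c * h`_k`_i.
  by rewrite /p coefD !coefZ coefD coefCM coefXnM.
have sp : (size p <= 7)%N.
  apply/leq_sizeP => j j7; rewrite /p coefD !coefZ.
  by rewrite (nth_default 0 (leq_trans sf j7)) (nth_default 0 (leq_trans sh j7))
    !mulr0 addr0.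
have spD k : (size (p`_k)%R <= 4)%N.
  apply/leq_sizeP => j j4; rewrite cp ltnNge (leq_trans _ j4) //=.
  rewrite (nth_default 0 (leq_trans (sfD k) _)) ?(nth_default 0 (leq_trans (shD k) _)) //.
  + by rewrite mulr0 addr0.
  + by rewrite (leq_trans _ j4).
  by rewrite leq_subRL ?(leq_trans _ j4).
have H n i : (4 <= n)%N -> p`_(n - 2 + i)`_i = 0.
  by move=> n4; apply: (weight_high sp spD Ip); lia.
have cI x : c * x = 0 -> x = 0.
  by move/eqP; rewrite mulf_eq0 (negbTE c0) => /eqP.
have h20 : h`_2`_0 = 0 by apply: (cI); have := H 4 0 isT; rewrite cp /= add0r.
have h31 : h`_3`_1 = 0 by apply: (cI); have := H 4 1 isT; rewrite cp /= add0r.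
have h42 : h`_4`_2 = 0.
  by apply: (cI); apply: (cI); rewrite mulrA -expr2 -R2.
have h2 n : (4 <= n)%N -> h`_n`_2 = 0.
  rewrite leq_eqVlt => /predU1P[<- //|]; case: n => [|[|n]] // n4.
  by case: (R1 n).
have h1 n : (3 <= n)%N -> h`_n`_1 = 0.
  rewrite leq_eqVlt => /predU1P[<- //|]; case: n => [|n] // n4.
  by case: (R1 n).
have h0 n : (2 <= n)%N -> h`_n`_0 = 0.
  rewrite leq_eqVlt => /predU1P[<- //|] n3; by case: (R1 n).
have f0 n : (4 <= n)%N -> f`_n`_0 = 0.
  by move=> n4; have := H n 2%N n4; rewrite subnK ?cp /= ?h2 ?mulr0 ?addr0 //; lia.
have f51 : f`_5`_1 = 0.
  by have := H 4 3 isT; rewrite cp /= (nth_default 0 (shD _)) mulr0 addr0.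
have h3 k : h`_k`_3 = 0 by rewrite (nth_default 0 (shD _)).
(* The quotient by (s - c)^3 is a constant, namely the s^3-coefficient b. *)
have W3 := dvdp_weight_low c0 sp spD (isT : (2 <= 3)%N) Ip.
have {}W3 := dvdp_XsubC_scale (size_poly _ _) W3.
have E3 : ('X - c%:P) ^+ 3 = 'X^3 - (3 * c) *: 'X^2 + (3 * c ^+ 2) *: 'X - (c ^+ 3)%:P.
  by rewrite -!mul_polyC !polyCM polyC_natr; ring.
have W3c i : (i < 4)%N -> p`_(1 + i)`_i = b * (('X - c%:P) ^+ 3)`_i.
  move=> i4; have := congr1 (fun q : {poly M} => q`_i) W3.
  rewrite coefZ !coef_poly i4 /= => ->; congr (_ * _).
  by rewrite cp /= h3 mulr0 addr0.
have := W3c 0 isT; have := W3c 1 isT; have := W3c 2 isT.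
have [D0 D1 D2] : [/\ (('X - c%:P) ^+ 3)`_0 = - c ^+ 3,
    (('X - c%:P) ^+ 3)`_1 = 3 * c ^+ 2 & (('X - c%:P) ^+ 3)`_2 = - (3 * c)].
  by split; rewrite E3 !coefE /=; ring.
rewrite D0 D1 D2 !cp /= => w2 w1 w0.
have h10 : h`_1`_0 = - c ^+ 2 * b.
  apply: (mulfI c0); move: w0; rewrite add0r => ->; ring.
have h21 : h`_2`_1 = 3 * c * b.
  apply: (mulfI c0); move: w1; rewrite add0r => ->; ring.
have h32 : h`_3`_2 = - 2 * b.
  apply: (mulfI (expf_neq0 2 c0)).
  have -> : c ^+ 2 * h`_3`_2 = (h`_1`_0 + c * h`_2`_1 + c ^+ 2 * h`_3`_2) - h`_1`_0
    - c * h`_2`_1 by ring.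
  by rewrite R3 h10 h21; ring.
have f30 : f`_3`_0 = - c * b.
  have -> : f`_3`_0 = f`_3`_0 + c * h`_3`_2 - c * h`_3`_2 by ring.
  by rewrite w2 h32; ring.
have := weight_root' sp spD Ip (leqnn 2) isT.
have := weight_root sp spD Ip (leqnn 2) isT.
rewrite !big_ord_recr !big_ord0 /= !cp /= h3 => E21 E22.
have h11 : h`_1`_1 = - 2 * (f`_2`_0 + c * h`_2`_2) - 3 * c * f`_3`_1.
  apply: (mulfI c0); apply/eqP; rewrite -subr_eq0 -[X in _ == X]E22; apply/eqP; ring.
have h00 : h`_0`_0 = c * (f`_2`_0 + c * h`_2`_2) + 2 * c ^+ 2 * f`_3`_1.
  apply: (mulfI c0); apply/eqP; rewrite -subr_eq0 -[X in _ == X]E21 h11; apply/eqP; ring.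
(* Here n = 1 < e = 2, so the powers of s start at 0 and dvdp_weight applies as
   it stands. *)
have := dvdp_weight 1 sp Ip; rewrite expr1 dvdp_XsubCl => /rootP.
rewrite horner_poly !big_ord_recr !big_ord0 /= !cp /= !h3 => E1.
have h01 : h`_0`_1 = - (f`_1`_0 + c * h`_1`_2) - c * f`_2`_1.
  apply: (mulfI c0); apply/eqP; rewrite -subr_eq0 -[X in _ == X]E1; apply/eqP.
  have fz k i : (2 <= i)%N -> f`_k`_i = 0.
    by move=> i2; rewrite nth_default // (leq_trans (sfD _)).
  have hz k i : (3 <= i)%N -> h`_k`_i = 0.
    by move=> i3; rewrite nth_default // (leq_trans (shD _)).
  rewrite [f`_3`_ _]fz // [f`_4`_ _]fz // [f`_5`_ _]fz // [f`_6`_ _]fz //.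
  by rewrite [h`_3`_ _]hz // [h`_4`_ _]hz // [h`_5`_ _]hz // [h`_6`_ _]hz //; ring.
by split; split.
Qed.
End TranslationChart.

(** * The D_4^(1) system on a fibre of x - y *)

(** The coefficients of P and R as polynomials in x and z, after y = x - q.  The
    letters u and v are used for the low coefficients of E2 and A; s1 and s2 are
    elementary symmetric functions of the roots eta, q, q + 1. *)
Section FibreForm.
Variables (A : comNzRingType) (e a0 a1 a2 a3 a4 q : A).

Definition fib_w := 2 * q + 1 - e.
Definition fib_s1 := e + 2 * q + 1.
Definition fib_s2 := e * q + e * (q + 1) + q * (q + 1).
Definition fib_u0 := - e * q * (q + 1) * fib_w.
Definition fib_u1 := 2 * (q ^+ 2 + (1 + 2 * e) * q + e) * fib_w.
Definition fib_u2 := - 3 * (2 * q + 1 + e) * fib_w.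
Definition fib_v2 :=
  a3 * (q + 1) * (q + 1 - e) + a4 * q * (q - e)
  + 2 * a2 * (3 * q ^+ 2 + 3 * q + 1 - e ^+ 2)
  - a0 * (q - e) * (q - e + 1) - a1 * q * (q + 1).
Definition fib_v1 :=
  fib_w * (a0 * (e - q) * (e - q - 1) + a1 * q * (q + 1) + 2 * a2 * e ^+ 2)
  - fib_v2 * e.
Definition quartic x := x * (x - e) * (x - q) * (x - (q + 1)).

Definition fibP0 x :=
  a1 * fib_u0 + fib_v1 * x + fib_v2 * x ^+ 2 - 2 * a2 * fib_w * x ^+ 3.
Definition fibR2 x := fib_u0 + fib_u1 * x + fib_u2 * x ^+ 2 + 4 * fib_w * x ^+ 3.
Definition fibR1 x :=
  - (fib_v1 - a2 * fib_u1) - 2 * a2 * fib_w * fib_s2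
  + (- 2 * (fib_v2
    - a2 * fib_u2) + 6 * a2 * fib_w * fib_s1) * x + 6 * a2 * fib_w * x ^+ 2.
Definition fibR0 x :=
  - a2 * (fib_v2 - a2 * fib_u2) + 4 * a2 ^+ 2 * fib_w * fib_s1 + 2 * a2 ^+ 2 * fib_w * x.

Hypothesis sum_a : a0 + a1 + 2 * a2 + a3 + a4 = 1.

Let a0E : a0 = 1 - a1 - 2 * a2 - a3 - a4.
Proof. by rewrite -[X in X - a1]sum_a; ring. Qed.

Lemma D4_P_xq x z :
  D4_P e a0 a1 a2 a3 a4 x (x - q) z
  = fibP0 x - 2 * fib_w * quartic x * z.
Proof.
rewrite /D4_P /fibP0 /quartic /fib_v1 /fib_v2 /fib_u0 /fib_w a0E. ring.
Qed.

Lemma D4_PQ_xq x z :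
  D4_P e a0 a1 a2 a3 a4 x (x - q) z + D4_Q e a0 a1 a2 a3 a4 x (x - q) z
  = fibP0 q + a4 * fib_w * q * (q - e).
Proof.
rewrite /D4_P /D4_Q /fibP0 /fib_v1 /fib_v2 /fib_u0 /fib_w a0E; ring.
Qed.

Lemma D4_R_xq x z :
  D4_R e a0 a1 a2 a3 a4 x (x - q) z
  = fibR2 x * z ^+ 2 + fibR1 x * z + fibR0 x.
Proof.
rewrite /D4_R /fibR2 /fibR1 /fibR0 /fib_v1 /fib_v2 /fib_u0 /fib_u1 /fib_u2 /fib_s1
  /fib_s2 /fib_w a0E; ring.
Qed.

End FibreForm.

Section Scalars.
Variables (M : fieldType) (M0 : [pchar M] =i pred0).
Variables (e a0 a1 a2 a3 a4 q k b : M).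
Hypotheses (e0 : e != 0) (q0 : q != 0) (eq0 : e - q != 0) (w0 : fib_w e q != 0).
Hypothesis kE : b = - 2 * fib_w e q * k.

Let two0 : 2 != 0 :> M.
Proof. by have /pcharf0P -> := M0. Qed.

(** The conditions 2 E2(r) + B'(r) = 0 at 0, e and q determine the three unknown
    coefficients of E2; the values of B' are those of
    b x (x - e) (x - q) (x - q - 1). *)
Lemma scalar_E2 (u0 u1 u2 : M) (E2 :=
  fun x => u0 + u1 * x + u2 * x ^+ 2 - 2 * b * x ^+ 3) :
  2 * E2 0 + b * (- e * q * (q + 1)) = 0 ->
  2 * E2 e + b * (e * (e - q) * (e - q - 1)) = 0 ->
  2 * E2 q + b * (- q * (q - e)) = 0 ->
  [/\ u0 = k * fib_u0 e q, u1 = k * fib_u1 e q & u2 = k * fib_u2 e q].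
Proof.
rewrite {}/E2 => h0 h1 h2.
have U0 : u0 = k * fib_u0 e q.
  apply: (mulfI two0); apply/eqP; rewrite -subr_eq0 -[X in _ == X]h0; apply/eqP.
  rewrite kE /fib_u0; ring.
have V1 : u1 + e * u2 = k * (fib_u1 e q + e * fib_u2 e q).
  apply: (mulfI two0); apply: (mulfI e0); apply/eqP;
    rewrite -subr_eq0 -[X in _ == X]h1; apply/eqP.
  rewrite kE U0 /fib_u0 /fib_u1 /fib_u2 /fib_w; ring.
have V2 : u1 + q * u2 = k * (fib_u1 e q + q * fib_u2 e q).
  apply: (mulfI two0); apply: (mulfI q0); apply/eqP;
    rewrite -subr_eq0 -[X in _ == X]h2; apply/eqP.
  rewrite kE U0 /fib_u0 /fib_u1 /fib_u2 /fib_w; ring.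
have U2 : u2 = k * fib_u2 e q.
  apply: (mulfI eq0).
  have -> : (e - q) * u2 = (u1 + e * u2) - (u1 + q * u2) by ring.
  by rewrite V1 V2; ring.
split => //.
have -> : u1 = (u1 + e * u2) - e * u2 by ring.
by rewrite V1 U2; ring.
Qed.

(** The condition at e involves c1 + e c2, and the difference of those at q + 1
    and q involves c1 + (2 q + 1) c2; solving for c2 means dividing by
    2 q + 1 - e. *)
Lemma scalar_A (c1 c2 h : M) (E2 := fun x => k * fibR2 e q x)
    (A := fun x => a1 * E2 0 + c1 * x + c2 * x ^+ 2 + a2 * b * x ^+ 3) :
  A e = a0 * E2 e -> A q - h = a4 * E2 q -> A (q + 1) - h = a3 * E2 (q + 1) ->
  [/\ c1 = k * fib_v1 e a0 a1 a2 a3 a4 q, c2 = k * fib_v2 e a0 a1 a2 a3 a4 q &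
      h = k * (fibP0 e a0 a1 a2 a3 a4 q q + a4 * fib_w e q * q * (q - e))].
Proof.
rewrite {}/A {}/E2 => h1 h2 h3.
set p1 := fib_v1 _ _ _ _ _ _ _; set p2 := fib_v2 _ _ _ _ _ _ _.
have V1 : c1 + e * c2 = k * (p1 + e * p2).
  apply: (mulfI e0); apply/eqP; rewrite -subr_eq0; apply/eqP.
  move/eqP: h1; rewrite -subr_eq0 => /eqP <-.
  rewrite kE /p1 /p2 /fibR2 /fib_v1 /fib_v2 /fib_u0 /fib_u1 /fib_u2 /fib_w; ring.
have V2 : c1 + (2 * q + 1) * c2 = k * (p1 + (2 * q + 1) * p2).
  apply/eqP; rewrite -subr_eq0; apply/eqP.
  have -> : 0 = (a1 * (k * fibR2 e q 0) + c1 * (q + 1) + c2 * (q + 1) ^+ 2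
    + a2 * b * (q + 1) ^+ 3 - h)
   - a3 * (k * fibR2 e q (q + 1)) - ((a1 * (k * fibR2 e q 0) + c1 * q + c2 * q ^+ 2
     + a2 * b * q ^+ 3 - h)
   - a4 * (k * fibR2 e q q)) by rewrite h2 h3; ring.
  rewrite kE /p1 /p2 /fibR2 /fib_v1 /fib_v2 /fib_u0 /fib_u1 /fib_u2 /fib_w; ring.
have U2 : c2 = k * p2.
  apply: (mulfI w0).
  have -> : fib_w e q * c2 = (c1 + (2 * q + 1) * c2) - (c1 + e * c2) by rewrite /fib_w;
    ring.
  by rewrite V1 V2 /fib_w; ring.
have U1 : c1 = k * p1.
  have -> : c1 = (c1 + e * c2) - e * c2 by ring.
  by rewrite V1 U2; ring.
split => //.
have -> : h = (a1 * (k * fibR2 e q 0) + c1 * q + c2 * q ^+ 2 + a2 * b * q ^+ 3)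
  - a4 * (k * fibR2 e q q).
  by rewrite -h2; ring.
rewrite U1 U2 kE /fibP0 -/p1 -/p2 /fibR2 /fib_u0 /fib_u1 /fib_u2 /fib_w; ring.
Qed.

End Scalars.

(** * Uniqueness on a fibre *)

Definition integral (S : idomainType) (p : {poly {fraction S}}) : Prop :=
  forall j, exists g : S, p`_j = g%:F.

Section Fibre.
Variables (M : fieldType) (M0 : [pchar M] =i pred0).
Local Notation T := {poly {poly M}}.

Lemma double_root_eq0 (rs : seq M) (r : M) (p : {poly M}) :
  uniq rs -> r \in rs -> {in rs, forall t, root p t} ->
  (forall u, p = u * ('X - r%:P) -> root u r) ->
  (size p <= (size rs).+1)%N -> p = 0.
Proof.
move=> urs rrs hp hu sp; have /factor_theorem[u pu] := hp r rrs.
suff u0 : u = 0 by rewrite pu u0 mul0r.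
apply: (all_roots_eq0 urs) => [t trs|].
  have [->|tr] := eqVneq t r; first exact: hu.
  have := hp t trs; rewrite pu rootM root_XsubC orbC.
  by rewrite (negbTE tr).
have [->|u0] := eqVneq u 0; first by rewrite size_poly0.
by move: sp; rewrite pu size_Mmonic ?monicXsubC // size_XsubC addn2.
Qed.

Lemma coef_shift_high (S : idomainType) (s : {fraction S}) (p : {poly S}) j :
  (size p <= j)%N -> (shift s p)`_j = 0.
Proof.
by move=> sp; rewrite (coef_shift _ _ sp) big1 // => k _; rewrite bin_small ?mulr0n.
Qed.

Lemma size_drop_last (R : nzRingType) (p : {poly R}) n :
  (size p <= n.+1)%N -> p`_n = 0 -> (size p <= n)%N.
Proof.
move=> sp pn; apply/leq_sizeP => j; rewrite leq_eqVlt => /predU1P[<-//|].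
by move/leq_sizeP: sp; apply.
Qed.

(** Here f is the derivative of the linear form x - r, that is, the right-hand
    side for x or for y, and g is the other one. *)
Definition chart_regular (a r : M) (f g p : T) : Prop :=
  [/\ integral (shift (pole a r) f), integral (shift (pole a r) g) &
      integral (shift (pole a r) p
        + (a%:P%:F / ('X - r%:P)%:F ^+ 2)%:P * shift (pole a r) f)].

Section Bounds.
Variables (cs : seq (M * M)) (c1 : M * M) (f g p : T).
Hypotheses (u : uniq [seq c.2 | c <- cs]) (s4 : size cs = 4%N).
Hypothesis nz : {in cs, forall c, c.1 != 0}.
Hypotheses (sf : (size f <= 7)%N) (sfk : forall k, (size (f`_k)%R <= 7 - k)%N).
Hypothesis I : {in cs, forall c, integral (shift (pole c.1 c.2) f)}.

Lemma chart_size_le3 : (size f <= 3)%N.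
Proof.
by apply: (size_shift M0 u s4 nz sf sfk (leqnn 2)) => c /I H j _; apply: H.
Qed.

Hypotheses (sp : (size p <= 7)%N) (spk : forall k, (size (p`_k)%R <= 7 - k)%N).
Hypothesis sg : (size g <= 3)%N.

Lemma chart_size_le4 :
  {in cs, forall c, chart_regular c.1 c.2 f g p \/ chart_regular c.1 c.2 g f p} ->
  (size p <= 4)%N.
Proof.
move=> H; apply: (size_shift M0 u s4 nz sp spk (isT : (2 <= 3)%N)) => c cc j j3.
have hi (h : T) : (size h <= 3)%N -> (shift (pole c.1 c.2) h)`_j = 0.
  by move=> sh; apply: coef_shift_high; apply: leq_trans j3.
have [[_ _ /(_ j)[v]]|[_ _ /(_ j)[v]]] := H c cc; rewrite coefD coefCM.
  by rewrite (hi f chart_size_le3) mulr0 addr0 => ->; exists v.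
by rewrite (hi g sg) mulr0 addr0 => ->; exists v.
Qed.

Hypothesis sp4 : (size p <= 4)%N.

Lemma chart_size_le2 :
  c1 \in cs -> chart_regular c1.1 c1.2 f g p -> (size f <= 2)%N.
Proof.
move=> cc [_ _ H]; have s3 := chart_size_le3.
have hr : {in [seq c.2 | c <- cs], forall r, root f`_2 r}.
  move=> _ /mapP[c /[dup] /I H2 /nz a0 ->]; have [v hv] := H2 1%N.
  exact: (root_lead_shift M0 a0 s3 hv).
apply: (size_drop_last s3).
apply: (double_root_eq0 u (map_f _ cc) hr); last by rewrite size_map s4 sfk.
by move=> v ev; have [] := z2_double_root (nz cc) H s3 sp4 ev.
Qed.

End Bounds.

Lemma root_coef3 (a r : M) (f g p : T) :
  a != 0 -> (size f <= 2)%N -> (size p <= 4)%N -> chart_regular a r f g p ->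
  root p`_3 r.
Proof.
move=> a0 sf sp [_ _ H].
have e : f`_2 = 0 * ('X - r%:P) by rewrite mul0r nth_default.
by have [] := z2_double_root a0 H (leq_trans sf (leqnSn _)) sp e.
Qed.

Lemma root_coef1 (a r : M) (f : T) :
  a != 0 -> (size f <= 2)%N -> integral (shift (pole a r) f) -> root f`_1 r.
Proof.
by move=> a0 sf /(_ 0%N)[v hv]; apply: (root_lead_shift M0 a0 sf hv).
Qed.

Lemma poly_cubic (p : {poly M}) : (size p <= 4)%N ->
  p = (p`_0)%:P + p`_1 *: 'X + p`_2 *: 'X^2 + p`_3 *: 'X^3.
Proof.
move=> sp; apply/polyP => i; rewrite !(coefD, coefZ, coefC, coefX, coefXn).
case: i => [|[|[|[|i]]]] /=; rewrite ?mulr0 ?mulr1 ?addr0 ?add0r //.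
by rewrite nth_default // (leq_trans sp).
Qed.
End Fibre.

Lemma size_swapXY (R : nzRingType) (p : {poly {poly R}}) n :
  (forall k, (size (p`_k)%R <= n)%N) -> (size (swapXY p) <= n)%N.
Proof.
move=> h; apply/leq_sizeP => j nj; apply/polyP => i.
by rewrite coef_swapXY coef0 nth_default // (leq_trans (h i)).
Qed.

Lemma size_coef_swapXY (R : nzRingType) (p : {poly {poly R}}) k :
  (size ((swapXY p)`_k)%R <= size p)%N.
Proof.
by apply/leq_sizeP => i pi; rewrite coef_swapXY (nth_default 0 pi) coef0.
Qed.

Definition constC (R : comNzRingType) : {rmorphism R -> {poly {poly R}}} :=
  polyC \o polyC.

Section RmorphFibreForm.
Variables (R S : comNzRingType) (phi : {rmorphism R -> S}).
Variables (e a0 a1 a2 a3 a4 q : R).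
Let rm := (rmorphD phi, rmorphN phi, rmorphM phi, rmorphXn phi,
  rmorph_nat phi, rmorph1 phi).

Lemma rmorph_fib_w : phi (fib_w e q) = fib_w (phi e) (phi q).
Proof. by rewrite /fib_w !rm. Qed.
Lemma rmorph_fib_s1 : phi (fib_s1 e q) = fib_s1 (phi e) (phi q).
Proof. by rewrite /fib_s1 !rm. Qed.
Lemma rmorph_fib_s2 : phi (fib_s2 e q) = fib_s2 (phi e) (phi q).
Proof. by rewrite /fib_s2 !rm. Qed.
Lemma rmorph_fib_u0 : phi (fib_u0 e q) = fib_u0 (phi e) (phi q).
Proof. by rewrite /fib_u0 /fib_w !rm. Qed.
Lemma rmorph_fib_u1 : phi (fib_u1 e q) = fib_u1 (phi e) (phi q).
Proof. by rewrite /fib_u1 /fib_w !rm. Qed.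
Lemma rmorph_fib_u2 : phi (fib_u2 e q) = fib_u2 (phi e) (phi q).
Proof. by rewrite /fib_u2 /fib_w !rm. Qed.
Lemma rmorph_fib_v2 : phi (fib_v2 e a0 a1 a2 a3 a4 q)
  = fib_v2 (phi e) (phi a0) (phi a1) (phi a2) (phi a3) (phi a4) (phi q).
Proof. by rewrite /fib_v2 !rm. Qed.
Lemma rmorph_fib_v1 : phi (fib_v1 e a0 a1 a2 a3 a4 q)
  = fib_v1 (phi e) (phi a0) (phi a1) (phi a2) (phi a3) (phi a4) (phi q).
Proof. by rewrite /fib_v1 /fib_w /fib_v2 !rm. Qed.

Definition rmorph_fib := (rmorph_fib_w, rmorph_fib_s1, rmorph_fib_s2, rmorph_fib_u0,
  rmorph_fib_u1, rmorph_fib_u2, rmorph_fib_v1, rmorph_fib_v2, rm).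
End RmorphFibreForm.

(** The polynomials f, g, p stand for the right-hand sides for x, y, z; the outer
    variable is z and the inner one x, and swapXY exchanges them. *)
Section FibreUniqueness.
Variables (M : fieldType) (M0 : [pchar M] =i pred0).
Local Notation T := {poly {poly M}}.
Variables (e a0 a1 a2 a3 a4 q : M).
Hypotheses (e_neq0 : e != 0) (a0_neq0 : a0 != 0) (a1_neq0 : a1 != 0)
  (a2_neq0 : a2 != 0) (a3_neq0 : a3 != 0) (a4_neq0 : a4 != 0).
Hypothesis sum_a : a0 + a1 + 2 * a2 + a3 + a4 = 1.
Hypotheses (rs_uniq : uniq [:: 0; e; q; q + 1]) (w_neq0 : fib_w e q != 0).
Variables f g p : T.
Hypotheses (sf : (size f <= 7)%N) (sfk : forall k, (size (f`_k)%R <= 7 - k)%N).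
Hypotheses (sg : (size g <= 7)%N) (sgk : forall k, (size (g`_k)%R <= 7 - k)%N).
Hypotheses (sp : (size p <= 7)%N) (spk : forall k, (size (p`_k)%R <= 7 - k)%N).
Hypotheses (H1 : chart_regular a1 0 f g p) (H0 : chart_regular a0 e f g p)
  (H4 : chart_regular a4 q g f p) (H3 : chart_regular a3 (q + 1) g f p).
Hypotheses (Lp : laurent_integral (- a2) 0 (swapXY p))
  (Ld : laurent_integral (- a2) 0 (swapXY (f - g)))
  (Lf : laurent_integral (- a2) 2 ('X^2 *: swapXY f + (- a2)%:P *: swapXY p)).

Let cs := [:: (a1, 0); (a0, e); (a4, q); (a3, q + 1)].

Let ucs : uniq [seq c.2 | c <- cs] := rs_uniq.

Let ball_cs (P : M * M -> Prop) :
  P (a1, 0) -> P (a0, e) -> P (a4, q) -> P (a3, q + 1) -> {in cs, forall c, P c}.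
Proof.
move=> h1 h0 h4 h3 c; rewrite !inE.
by case/or4P => /eqP ->.
Qed.

Let nz : {in cs, forall c, c.1 != 0}.
Proof. exact: ball_cs. Qed.

Let If : {in cs, forall c, integral (shift (pole c.1 c.2) f)}.
Proof.
by apply: ball_cs; [case: H1|case: H0|case: H4|case: H3].
Qed.

Let Ig : {in cs, forall c, integral (shift (pole c.1 c.2) g)}.
Proof.
by apply: ball_cs; [case: H1|case: H0|case: H4|case: H3].
Qed.

Let sf3 := chart_size_le3 M0 ucs (erefl : size cs = 4%N) nz sf sfk If.
Let sg3 := chart_size_le3 M0 ucs (erefl : size cs = 4%N) nz sg sgk Ig.

Let sp4 : (size p <= 4)%N.
Proof.
apply: (chart_size_le4 M0 ucs (erefl : size cs = 4%N) nz sf sfk If sp spk sg3).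
by apply: ball_cs; [left|left|right|right].
Qed.

Let sf2 : (size f <= 2)%N.
Proof.
apply: (chart_size_le2 (c1 := (a1, 0)) M0 ucs (erefl : size cs
  = 4%N) nz sf sfk If sp4 _ H1).
by rewrite inE eqxx.
Qed.

Let sg2 : (size g <= 2)%N.
Proof.
apply: (chart_size_le2 (c1 := (a4, q)) M0 ucs (erefl : size cs
  = 4%N) nz sg sgk Ig sp4 _ H4).
by rewrite !inE eqxx !orbT.
Qed.

Let sp3 : (size p <= 3)%N.
Proof.
apply: (size_drop_last sp4); apply: (all_roots_eq0 rs_uniq); last exact: spk.
move=> r; rewrite !inE => /or4P[] /eqP ->.
- exact: (root_coef3 a1_neq0 sf2 sp4 H1).
- exact: (root_coef3 a0_neq0 sf2 sp4 H0).
- exact: (root_coef3 a4_neq0 sg2 sp4 H4).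
- exact: (root_coef3 a3_neq0 sg2 sp4 H3).
Qed.

Let Fx := swapXY f.
Let Px := swapXY p.
Let sFx : (size Fx <= 7)%N.
Proof. by apply: size_swapXY => k; apply: leq_trans (sfk k) (leq_subr _ _). Qed.
Let sPx : (size Px <= 7)%N.
Proof. by apply: size_swapXY => k; apply: leq_trans (spk k) (leq_subr _ _). Qed.
Let sFxk k : (size (Fx`_k)%R <= 2)%N.
Proof. exact: leq_trans (size_coef_swapXY _ _) sf2. Qed.
Let sPxk k : (size (Px`_k)%R <= 3)%N.
Proof. exact: leq_trans (size_coef_swapXY _ _) sp3. Qed.

Let b := f`_1`_4.
Let ell : {poly M} := quartic e%:P q%:P 'X.

Let ell_coef : ell = 'X^4 - (fib_s1 e q) *: 'X^3 + (fib_s2 e q) *: 'X^2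
  - (e * q * (q + 1)) *: 'X.
Proof.
rewrite /ell /quartic /fib_s1 /fib_s2 -!mul_polyC !(polyCD, polyCM, polyC_natr); ring.
Qed.

(* A polynomial of degree at most 4 with the four roots is a multiple of ell. *)
Let multiple_of_ell (h : {poly M}) : {in [:: 0; e; q; q + 1], forall r, root h r} ->
  (size h <= 6)%N -> h`_5 = 0 -> h = h`_4 *: ell.
Proof.
move=> hr sh h5; apply/eqP; rewrite -subr_eq0; apply/eqP.
apply: (all_roots_eq0 rs_uniq).
  move=> r rr; rewrite /root hornerD hornerN hornerZ (rootP (hr r rr)) sub0r oppr_eq0.
  move: rr; rewrite !inE => rr.
  rewrite mulf_eq0; apply/orP; right.
  rewrite /ell /quartic -polyC1 -!polyCD !hornerM !hornerXsubC hornerX.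
  by rewrite !mulf_eq0 !subr_eq0 -!orbA; case/or4P: rr => ->; rewrite ?orbT.
apply/leq_sizeP => j; rewrite leq_eqVlt => /predU1P[<-|].
  rewrite coefB coefZ ell_coef !(coefD, coefN, coefZ, coefX, coefXn) /=.
  by rewrite !mulr0 !oppr0 !addr0 mulr1 subrr.
rewrite leq_eqVlt => /predU1P[<-|j6].
  rewrite coefB coefZ ell_coef !(coefD, coefN, coefZ, coefX, coefXn) /=.
  by rewrite !mulr0 !oppr0 !addr0 mulr0 subr0.
rewrite coefB coefZ ell_coef !(coefD, coefN, coefZ, coefX, coefXn).
rewrite (nth_default 0 (leq_trans sh j6)).
case: j j6 => [|[|[|[|[|j]]]]] //= _.
by rewrite !mulr0 !oppr0 !addr0 mulr0 subr0.
Qed.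

Let roots_cs (h : T) : (size h <= 2)%N ->
  {in cs, forall c, integral (shift (pole c.1 c.2) h)} ->
  {in [:: 0; e; q; q + 1], forall r, root h`_1 r}.
Proof.
move=> sh Ih r rr; have /mapP[c cc ->] : r \in [seq c.2 | c <- cs] by [].
exact: (root_coef1 M0 (nz cc) sh (Ih c cc)).
Qed.

Let na2 : - a2 != 0.
Proof. by rewrite oppr_eq0. Qed.

Let chart2 := laurent_P na2 sFx sFxk sPx sPxk Lp Lf.

Let b_lead : f`_1 = b *: ell.
Proof.
apply: multiple_of_ell; [exact: roots_cs|exact: sfk|].
by have [[_ _]] := chart2; rewrite coef_swapXY.
Qed.

(* The derivative of x - y in chart 2 is f - g: it has z-degree at most 1, so
   its parts of weight -2 and below vanish. *)
Let diff_const : (forall n, (2 <= n)%N -> (f - g)`_0`_n = 0)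
  /\ g`_1 = b *: ell /\ (f - g)`_0`_1 = 0.
Proof.
have sfg2 : (size (f - g)%R <= 2)%N.
  by rewrite (leq_trans (size_polyD _ _)) // size_polyN geq_max sf2 sg2.
have sd : (size (swapXY (f - g)%R) <= 7)%N.
  apply: size_swapXY => k;
    rewrite coefB (leq_trans (size_polyD _ _)) // size_polyN geq_max.
  by rewrite (leq_trans (sfk k) (leq_subr _ _)) (leq_trans (sgk k) (leq_subr _ _)).
have sdk k : (size ((swapXY (f - g)%R)`_k)%R <= 2)%N.
  exact: leq_trans (size_coef_swapXY _ _) sfg2.
have [D0 D1 D2] := laurent_diff na2 sd sdk Ld.
have d1 n : (3 <= n)%N -> g`_1`_n = f`_1`_n.
  by move=> /D1; rewrite coef_swapXY !coefB => /eqP; rewrite subr_eq0 => /eqP.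
have e1 : g`_1 = b *: ell.
  rewrite /b -(d1 4%N) //; apply: multiple_of_ell; [exact: roots_cs|exact: sgk|].
  by rewrite d1 // b_lead coefZ ell_coef !(coefD, coefN, coefZ, coefX, coefXn) /=
    !mulr0 !oppr0 !addr0 mulr0.
split; first by move=> n /D0; rewrite coef_swapXY.
split=> //; move: D2; rewrite !coef_swapXY [(f - g)`_1]coefB e1 b_lead subrr coef0.
by rewrite mulr0 addr0.
Qed.

Let h := f`_0`_0 - g`_0`_0.

Let g0E : g`_0 = f`_0 - h%:P.
Proof.
have [d2 [_ d1]] := diff_const.
suff -> : h%:P = f`_0 - g`_0 by ring.
rewrite -coefB; apply/polyP => -[|[|n]]; rewrite coefC /=.
- by rewrite !coefB.
- by rewrite d1.
by rewrite d2.
Qed.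

Let u0 := p`_2`_0.
Let u1 := p`_2`_1.
Let u2 := p`_2`_2.

Let p2E : p`_2 = u0%:P + u1 *: 'X + u2 *: 'X^2 + (- 2 * b) *: 'X^3.
Proof.
have [_ [h2 _ _] [_ _ h32] _] := chart2.
rewrite -[X in X *: 'X^3](_ : p`_2`_3 = _); last by move: h32; rewrite !coef_swapXY.
apply: poly_cubic; apply/leq_sizeP => j /h2; by rewrite coef_swapXY.
Qed.

Let v1 := f`_0`_1.
Let v2 := f`_0`_2.

Let f0E : f`_0 = (f`_0`_0)%:P + v1 *: 'X + v2 *: 'X^2 + (a2 * b) *: 'X^3.
Proof.
have [[h2 h3 _] _ _ _] := chart2.
rewrite -[X in X *: 'X^3](_ : f`_0`_3 = _); last by move: h3; rewrite !coef_swapXY opprK.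
apply: poly_cubic; apply/leq_sizeP => j /h2; by rewrite coef_swapXY.
Qed.

Let cubicE (t0 t1 t2 t3 r : M) :
  (t0%:P + t1 *: 'X + t2 *: 'X^2 + t3 *: 'X^3).[r]
    = t0 + t1 * r + t2 * r ^+ 2 + t3 * r ^+ 3.
Proof. by rewrite !hornerE. Qed.

Let k := - b / (2 * fib_w e q).

Let two0 : 2 != 0 :> M.
Proof. by have /pcharf0P -> := M0. Qed.

Let kE : b = - 2 * fib_w e q * k.
Proof. by rewrite /k; field; rewrite two0 w_neq0. Qed.

Let E2 x := u0 + u1 * x + u2 * x ^+ 2 - 2 * b * x ^+ 3.

Let at_root (c r : M) (f' g' : T) (v : {poly M}) : c != 0 -> (size f' <= 2)%N ->
  chart_regular c r f' g' p -> f'`_1 = v * ('X - r%:P) ->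
  2 * E2 r + v.[r] = 0 /\ (f'`_0).[r] = c * E2 r.
Proof.
move=> c0 s2 [_ _ H] e1; have := root_relations c0 H s2 sp3 e1.
by rewrite p2E cubicE /E2 !mulNr.
Qed.

Let uE : [/\ u0 = k * fib_u0 e q, u1 = k * fib_u1 e q & u2 = k * fib_u2 e q].
Proof.
move: (rs_uniq); rewrite /= !inE !negb_or -!andbA => /and4P[_ q0 _ /andP[eq _]].
have g1 := proj1 (proj2 diff_const).
have e1 : f`_1 = (b *: (('X - e%:P) * ('X - q%:P) * ('X - (q + 1)%:P))) * ('X - 0%:P).
  by rewrite b_lead /ell /quartic polyC0 subr0 polyCD polyC1 -!mul_polyC; ring.
have e2 : f`_1 = (b *: ('X * ('X - q%:P) * ('X - (q + 1)%:P))) * ('X - e%:P).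
  by rewrite b_lead /ell /quartic polyCD polyC1 -!mul_polyC; ring.
have e3 : g`_1 = (b *: ('X * ('X - e%:P) * ('X - (q + 1)%:P))) * ('X - q%:P).
  by rewrite g1 /ell /quartic polyCD polyC1 -!mul_polyC; ring.
have [h0 _] := at_root a1_neq0 sf2 H1 e1.
have [h1 _] := at_root a0_neq0 sf2 H0 e2.
have [h2 _] := at_root a4_neq0 sg2 H4 e3.
apply: (scalar_E2 M0 e_neq0 _ _ kE).
- by rewrite eq_sym.
- by rewrite subr_eq0.
- move: h0; rewrite /E2 !(hornerZ, hornerM, hornerXsubC, hornerX) => h0;
  rewrite -[RHS]h0; ring.
- move: h1; rewrite /E2 !(hornerZ, hornerM, hornerXsubC, hornerX) => h1;
  rewrite -[RHS]h1; ring.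
move: h2; rewrite /E2 !(hornerZ, hornerM, hornerXsubC, hornerX) => h2;
  rewrite -[RHS]h2; ring.
Qed.

Let E2E x : E2 x = k * fibR2 e q x.
Proof.
have [h0 h1 h2] := uE.
by rewrite /E2 h0 h1 h2 kE /fibR2; ring.
Qed.

Let vE : [/\ f`_0`_0 = k * (a1 * fib_u0 e q), v1 = k * fib_v1 e a0 a1 a2 a3 a4 q,
   v2 = k * fib_v2 e a0 a1 a2 a3 a4 q &
   h = k * (fibP0 e a0 a1 a2 a3 a4 q q + a4 * fib_w e q * q * (q - e))].
Proof.
have fac (r : M) (t : T) : root t`_1 r -> exists v, t`_1 = v * ('X - r%:P).
  by move=> /factor_theorem.
have [m0 m1 m2 m3] : [/\ 0 \in [:: 0; e; q; q + 1], e \in [:: 0; e; q; q + 1],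
    q \in [:: 0; e; q; q + 1] & q + 1 \in [:: 0; e; q; q + 1]].
  by rewrite !inE !eqxx !orbT.
have [x1 e1] := fac 0 f (roots_cs sf2 If m0).
have [x2 e2] := fac e f (roots_cs sf2 If m1).
have [x3 e3] := fac q g (roots_cs sg2 Ig m2).
have [x4 e4] := fac (q + 1) g (roots_cs sg2 Ig m3).
have [_ A1] := at_root a1_neq0 sf2 H1 e1.
have [_ A2] := at_root a0_neq0 sf2 H0 e2.
have [_ A3] := at_root a4_neq0 sg2 H4 e3.
have [_ A4] := at_root a3_neq0 sg2 H3 e4.
rewrite f0E cubicE E2E !mulr0 !expr0n /= !mulr0 !addr0 in A1.
rewrite f0E cubicE E2E in A2.
rewrite g0E !(hornerD, hornerN, hornerC) f0E cubicE E2E in A3.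
rewrite g0E !(hornerD, hornerN, hornerC) f0E cubicE E2E in A4.
rewrite A1 in A2 A3 A4.
have [V1 V2 V3] := scalar_A e_neq0 w_neq0 kE A2 A3 A4.
by split; rewrite // A1 /fibR2; ring.
Qed.

Let f13 : f`_1`_3 = - (b * fib_s1 e q).
Proof.
rewrite b_lead coefZ ell_coef !(coefD, coefN, coefZ, coefX, coefXn) /=.
by rewrite !mulr0 !oppr0 !addr0 add0r mulr1 mulrN.
Qed.

Let f12 : f`_1`_2 = b * fib_s2 e q.
Proof.
rewrite b_lead coefZ ell_coef !(coefD, coefN, coefZ, coefX, coefXn) /=.
by rewrite !mulr0 !oppr0 !addr0 add0r mulr1.
Qed.

Let p1E : p`_1 =
  (k * (- (fib_v1 e a0 a1 a2 a3 a4 q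
    - a2 * fib_u1 e q) - 2 * a2 * fib_w e q * fib_s2 e q))%:P
  + (k * (- 2 * (fib_v2 e a0 a1 a2 a3 a4 q
    - a2 * fib_u2 e q) + 6 * a2 * fib_w e q * fib_s1 e q)) *: 'X
  + (k * (6 * a2 * fib_w e q)) *: 'X^2 + 0 *: 'X^3.
Proof.
have [_ [_ h1 _] [_ h21 _] [h11 _ h01]] := chart2.
move: h21 h11 h01; rewrite !coef_swapXY -/b -/u1 -/u2 -/v1 -/v2 f12 f13 => h21 h11 h01.
have h13 : p`_1`_3 = 0 by have := h1 3%N isT; rewrite coef_swapXY.
have s1 : (size (p`_1)%R <= 4)%N.
  apply/leq_sizeP => j j4; have := h1 j (ltnW j4); by rewrite coef_swapXY.
have [_ U1 U2] := uE; have [_ V1 V2 _] := vE.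
rewrite [LHS](poly_cubic s1) h01 h11 h21 h13 U1 U2 V1 V2 kE.
by congr (_%:P + _ *: _ + _ *: _ + _); ring.
Qed.

Let p0E : p`_0 =
  (k * (- a2 * (fib_v2 e a0 a1 a2 a3 a4 q
    - a2 * fib_u2 e q) + 4 * a2 ^+ 2 * fib_w e q * fib_s1 e q))%:P
  + (k * (2 * a2 ^+ 2 * fib_w e q)) *: 'X + 0 *: 'X^2 + 0 *: 'X^3.
Proof.
have [_ [_ _ h0] [h10 _ _] [_ h00 _]] := chart2.
move: h10 h00; rewrite !coef_swapXY -/b -/u1 -/u2 -/v1 -/v2 f13 => h10 h00.
have h02 : p`_0`_2 = 0 by have := h0 2%N isT; rewrite coef_swapXY.
have h03 : p`_0`_3 = 0 by have := h0 3%N isT; rewrite coef_swapXY.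
have s1 : (size (p`_0)%R <= 4)%N.
  apply/leq_sizeP => j j4; have := h0 j (leq_trans (isT : (2 <= 4)%N) j4);
    by rewrite coef_swapXY.
have [_ U1 U2] := uE; have [_ V1 V2 _] := vE.
rewrite [LHS](poly_cubic s1) h00 h10 h02 h03 U2 V2 kE.
by congr (_%:P + _ *: _ + _ + _); ring.
Qed.

Local Notation io := (@constC M).
Local Notation X := ('X%:P : T).
Local Notation Y := ('X%:P - io q : T).

Let sumI : io a0 + io a1 + 2 * io a2 + io a3 + io a4 = 1.
Proof.
transitivity (io (a0 + a1 + 2 * a2 + a3 + a4)); last by rewrite sum_a rmorph1.
by rewrite !(rmorphD io) (rmorphM io) rmorph_nat.
Qed.

Let cubicI (t0 t1 t2 t3 : M) :
  (t0%:P + t1 *: 'X + t2 *: 'X^2 + t3 *: 'X^3)%:P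
  = io t0 + io t1 * X + io t2 * X ^+ 2 + io t3 * X ^+ 3.
Proof. by rewrite -!mul_polyC !polyCD !polyCM. Qed.

Let ellI : ell%:P = quartic (io e) (io q) X.
Proof. by rewrite /ell /quartic !(polyCM, polyCD, polyCN, polyC1). Qed.

Let poly2 (t : T) : (size t <= 2)%N -> t = (t`_0)%:P + (t`_1)%:P * 'X.
Proof.
move=> st; apply/polyP => i; rewrite coefD coefC coefCM coefX.
case: i => [|[|i]] /=; rewrite ?mulr0 ?mulr1 ?addr0 ?add0r //.
by rewrite nth_default // (leq_trans st).
Qed.

Let poly3 (t : T) : (size t <= 3)%N ->
  t = (t`_0)%:P + (t`_1)%:P * 'X + (t`_2)%:P * 'X ^+ 2.
Proof.
move=> st; apply/polyP => i; rewrite !(coefD, coefC, coefCM, coefX, coefXn).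
case: i => [|[|[|i]]] /=; rewrite ?mulr0 ?mulr1 ?addr0 ?add0r //.
by rewrite nth_default // (leq_trans st).
Qed.

Let bI : (b *: ell)%:P = - 2 * fib_w (io e) (io q) * io k * quartic (io e) (io q) X.
Proof.
rewrite -mul_polyC polyCM ellI; congr (_ * _).
by rewrite {1}kE -[_%:P%:P]/(io _) !rmorph_fib.
Qed.

Let fE : f = io k * D4_P (io e) (io a0) (io a1) (io a2) (io a3) (io a4) X Y 'X.
Proof.
rewrite (D4_P_xq (io e) (io q) sumI) [LHS](poly2 sf2) f0E cubicI b_lead bI.
have [-> -> -> _] := vE; rewrite {1}kE !(rmorph_fib io) /fibP0.
move: (X) (fib_w _ _) (fib_u0 _ _) (fib_v1 _ _ _ _ _ _ _) (fib_v2 _ _ _ _ _ _ _).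
move=> x w v0 w1 w2; ring.
Qed.

Let gE : - g = io k * D4_Q (io e) (io a0) (io a1) (io a2) (io a3) (io a4) X Y 'X.
Proof.
set P := D4_P (io e) (io a0) (io a1) (io a2) (io a3) (io a4) X Y 'X.
set Q := D4_Q _ _ _ _ _ _ _ _ _.
have -> : - g = (f - g) - f by ring.
have -> : Q = (P + Q) - P by ring.
rewrite mulrBr -fE (D4_PQ_xq (io e) (io q) sumI); congr (_ - _).
have -> : f - g = io h.
  rewrite [f](poly2 sf2) [g](poly2 sg2) g0E (proj1 (proj2 diff_const)) b_lead.
  by rewrite polyCB [io h]/= opprD addrACA subrr addr0 opprB addrC subrK.
have [_ _ _ ->] := vE.
rewrite /fibP0 !(rmorph_fib io); ring.
Qed.

Let pE : p = io k * D4_R (io e) (io a0) (io a1) (io a2) (io a3) (io a4) X Y 'X.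
Proof.
rewrite (D4_R_xq (io e) (io q) sumI) [LHS](poly3 sp3) p0E p1E p2E !cubicI.
have [-> -> ->] := uE; rewrite {1}kE !(rmorph_fib io) /fibR2 /fibR1 /fibR0 !rmorph0.
move: (X) (fib_w _ _) (fib_u0 _ _) (fib_u1 _ _) (fib_u2 _ _) (fib_v1 _ _ _ _ _ _ _)
  (fib_v2 _ _ _ _ _ _ _) (fib_s1 _ _) (fib_s2 _ _).
move=> x w v0 v1' v2' w1 w2 s1 s2; ring.
Qed.

(** The two coefficients of f recorded at the end are those from which the
    multiplier c is shown to be constant. *)
Lemma fibre_D4 : exists c : M,
  [/\ f = io c * D4_P (io e) (io a0) (io a1) (io a2) (io a3) (io a4) X Y 'X,
      - g = io c * D4_Q (io e) (io a0) (io a1) (io a2) (io a3) (io a4) X Y 'X,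
      p = io c * D4_R (io e) (io a0) (io a1) (io a2) (io a3) (io a4) X Y 'X,
      f`_1`_4 = - 2 * fib_w e q * c & f`_0`_2 = c * fib_v2 e a0 a1 a2 a3 a4 q].
Proof. by exists k; split=> //; have [] := vE. Qed.
End FibreUniqueness.

(** * Derivations of fraction fields *)

Local Open Scope quotient_scope.

Lemma fraction_numden (A : idomainType) (q : {fraction A}) :
  exists n d : A, d != 0 /\ q = n%:F / d%:F.
Proof.
rewrite -[q]reprK; case: (repr q) => [[n d] /= d0].
exists n, d; split => //.
have h : d%:F != 0 by rewrite tofrac_eq0.
apply: (mulIf h); rewrite divfK //.
rewrite /tofrac; unlock FracField.tofrac; rewrite -[LHS]pi_mul.
apply/eqP; rewrite piE /= FracField.equivfE /FracField.mulf.
by rewrite !numden_Ratio ?oner_eq0 ?mulf_neq0 ?oner_eq0 //= ?mulr1 ?mul1r mulrC.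
Qed.

Section Derivations.
Variables (A : idomainType) (d : A -> A).
Hypothesis dD : forall u v, d (u + v) = d u + d v.
Hypothesis dM : forall u v, d (u * v) = d u * v + u * d v.

Lemma derivation1 : d 1 = 0.
Proof.
apply: (addIr (d 1)); rewrite add0r.
by have := dM 1 1; rewrite !mulr1 mul1r.
Qed.

Lemma derivation0 : d 0 = 0.
Proof. by apply: (addIr (d 0)); rewrite -dD !add0r. Qed.

Lemma derivationN u : d (- u) = - d u.
Proof. by apply: (addIr (d u)); rewrite -dD !addNr derivation0. Qed.

Lemma fracder_tofrac u : fracder d u%:F = (d u)%:F.
Proof.
rewrite -[u%:F]divr1 -tofrac1 fracderE ?oner_eq0 //.
by rewrite derivation1 mulr0 subr0 mulr1 expr1n tofrac1 divr1.
Qed.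

Lemma fracderD u v : fracder d (u + v) = fracder d u + fracder d v.
Proof.
have [n1 [d1 [d1_0 ->]]] := fraction_numden u.
have [n2 [d2 [d2_0 ->]]] := fraction_numden v.
have aux (L : fieldType) (x1 y1 x2 y2 dx1 dy1 dx2 dy2 : L) : y1 != 0 -> y2 != 0 ->
   (((dx1 * y2 + x1 * dy2) + (dx2 * y1 + x2 * dy1)) * (y1 * y2)
    - (x1 * y2 + x2 * y1) * (dy1 * y2 + y1 * dy2)) / (y1 * y2) ^+ 2
  = (dx1 * y1 - x1 * dy1) / y1 ^+ 2 + (dx2 * y2 - x2 * dy2) / y2 ^+ 2.
  by move=> ? ?; field; apply/andP.
rewrite addf_div ?tofrac_eq0 // -!tofracM -tofracD !fracderE ?mulf_neq0 //.
rewrite dD !dM !(tofracD, tofracN, tofracM, tofracXn).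
by apply: aux; rewrite tofrac_eq0.
Qed.

Lemma fracderM u v : fracder d (u * v) = fracder d u * v + u * fracder d v.
Proof.
have [n1 [d1 [d1_0 ->]]] := fraction_numden u.
have [n2 [d2 [d2_0 ->]]] := fraction_numden v.
have aux (L : fieldType) (x1 y1 x2 y2 dx1 dy1 dx2 dy2 : L) : y1 != 0 -> y2 != 0 ->
   ((dx1 * x2 + x1 * dx2) * (y1 * y2)
    - (x1 * x2) * (dy1 * y2 + y1 * dy2)) / (y1 * y2) ^+ 2
  = (dx1 * y1 - x1 * dy1) / y1 ^+ 2 * (x2 / y2)
    + x1 / y1 * ((dx2 * y2 - x2 * dy2) / y2 ^+ 2).
  by move=> ? ?; field; apply/andP.
rewrite mulf_div -!tofracM !fracderE ?mulf_neq0 //.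
rewrite !dM !(tofracD, tofracN, tofracM, tofracXn).
by apply: aux; rewrite tofrac_eq0.
Qed.

Lemma fracder_addV u a l : d a = 0 -> l != 0 ->
  fracder d (u%:F + a%:F / l%:F) = (d u)%:F - a%:F / l%:F ^+ 2 * (d l)%:F.
Proof.
move=> da l0; rewrite fracderD fracder_tofrac fracderE // da mul0r sub0r.
by rewrite tofracN tofracM tofracXn mulNr mulrAC.
Qed.

Lemma fracder_subV u a l : d a = 0 -> l != 0 ->
  fracder d (u%:F - a%:F / l%:F) = (d u)%:F + a%:F / l%:F ^+ 2 * (d l)%:F.
Proof.
move=> da l0; rewrite -mulNr -tofracN fracder_addV ?derivationN ?da ?oppr0 //.
by rewrite tofracN !mulNr opprK.
Qed.
End Derivations.

Section MapDerivation.
Variables (K : fieldType) (n : nat) (delta : {additive K -> K}).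
Hypothesis deltaM : forall u v, delta (u * v) = delta u * v + u * delta v.

(** By additivity in both factors it is enough to check terms c X^m. *)
Lemma map_mpoly_derivation (p q : {mpoly K[n]}) :
  map_mpoly delta (p * q) = map_mpoly delta p * q + p * map_mpoly delta q.
Proof.
have mapZ c (m : 'X_{1..n}) : map_mpoly delta (c *: 'X_[m]) = delta c *: 'X_[m].
  apply/mpolyP => k; rewrite mcoeff_map_mpoly !mcoeffZ !mcoeffX.
  by case: (m == k); rewrite ?mulr1 ?mulr0 ?raddf0.
elim/mpolyind: p => [|c m p _ _ IHp]; first by rewrite !mul0r raddf0 mul0r addr0.
rewrite mulrDl !raddfD /= IHp [in RHS]mulrDl [in RHS]mulrDl addrACA; congr (_ + _).
elim/mpolyind: q {IHp} => [|c' m' q _ _ IHq]; first by rewrite !mulr0 raddf0 mulr0 addr0.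
rewrite mulrDr !raddfD /= IHq [in RHS]mulrDr [in RHS]mulrDr addrACA; congr (_ + _).
rewrite -scalerAl -scalerAr scalerA -mpolyXD mapZ deltaM !mapZ.
by rewrite -!scalerAl -!scalerAr !scalerA -mpolyXD scalerDl.
Qed.
End MapDerivation.

(** * Specialising fractions along a chart *)

Section Transfer.
Variables (K : fieldType) (n : nat) (U : comUnitRingType).
Local Notation A := {mpoly K[n]}.
Variable eps : {rmorphism A -> U}.

(** The graph of the extension of eps to the localisation of A at the elements
    that eps makes invertible. *)
Definition specializes (F : {fraction A}) (u : U) : Prop :=
  exists a l : A, [/\ eps l \is a GRing.unit, F = a%:F / l%:F & u * eps l = eps a].

Let unit_neq0 l : eps l \is a GRing.unit -> l%:F != 0.
Proof.
move=> ul; rewrite tofrac_eq0; apply: contraTneq ul => ->.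
by rewrite rmorph0 unitr0.
Qed.

Lemma specializes_uniq F u v : specializes F u -> specializes F v -> u = v.
Proof.
move=> [a [l [ul -> e1]]] [a' [l' [ul' e e2]]].
have {}e : a * l' = a' * l.
  by apply/eqP; rewrite -tofrac_eq !tofracM -eqr_div ?unit_neq0 // e.
apply: (mulIr ul); apply: (mulIr ul').
by rewrite e1 mulrAC e2 -!rmorphM e.
Qed.

Lemma specializes_tofrac a : specializes a%:F (eps a).
Proof.
by exists a, 1; rewrite rmorph1 unitr1 tofrac1 divr1 mulr1.
Qed.

Lemma specializes_div a l u :
  eps l \is a GRing.unit -> u * eps l = eps a -> specializes (a%:F / l%:F) u.
Proof. by exists a, l. Qed.

Lemma specializesD F G u v :
  specializes F u -> specializes G v -> specializes (F + G) (u + v).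
Proof.
move=> [a [l [ul -> e1]]] [a' [l' [ul' -> e2]]]; exists (a * l' + a' * l), (l * l').
rewrite rmorphM unitrM ul ul'; split=> //.
  by rewrite addf_div ?unit_neq0 // -!tofracM -tofracD.
by rewrite rmorphD !rmorphM -e1 -e2; ring.
Qed.

Lemma specializesM F G u v :
  specializes F u -> specializes G v -> specializes (F * G) (u * v).
Proof.
move=> [a [l [ul -> e1]]] [a' [l' [ul' -> e2]]]; exists (a * a'), (l * l').
rewrite !rmorphM unitrM ul ul'; split=> //.
  by rewrite mulf_div -!tofracM.
by rewrite -e1 -e2; ring.
Qed.

Lemma specializesX F u k : specializes F u -> specializes (F ^+ k) (u ^+ k).
Proof.
move=> h; elim: k => [|k IH]; last by rewrite !exprS; apply: specializesM.
by rewrite !expr0 -tofrac1 -(rmorph1 eps); apply: specializes_tofrac.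
Qed.

Lemma specializes_mmap (c : 'I_n -> {fraction A}) (v : 'I_n -> U) (g : A) :
  (forall i, specializes (c i) (v i)) ->
  specializes (mmap (fun k => (k%:MP)%:F) c g) (mmap (fun k => eps k%:MP) v g).
Proof.
move=> h; rewrite /mmap; elim/big_ind2: _ => [|F u G w|m _].
- by rewrite -tofrac0 -(rmorph0 eps); apply: specializes_tofrac.
- exact: specializesD.
apply: specializesM; first exact: specializes_tofrac.
rewrite /mmap1; elim/big_ind2: _ => [|F u G w|i _].
- by rewrite -tofrac1 -(rmorph1 eps); apply: specializes_tofrac.
- exact: specializesM.
exact: specializesX.
Qed.
End Transfer.

Section ShiftMorphism.
Variables (S : idomainType) (s : {fraction S}).

Lemma shift_is_zmod_morphism : zmod_morphism (shift s).
Proof. by move=> u v; rewrite unlock !rmorphB. Qed.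
HB.instance Definition _ :=
  GRing.isZmodMorphism.Build _ _ (shift s) shift_is_zmod_morphism.

Lemma shift_is_monoid_morphism : monoid_morphism (shift s).
Proof. by split=> [|u v]; rewrite unlock ?rmorph1 ?rmorphM. Qed.
HB.instance Definition _ :=
  GRing.isMonoidMorphism.Build _ _ (shift s) shift_is_monoid_morphism.

Lemma shiftC (w : S) : shift s w%:P = w%:F%:P.
Proof. by rewrite unlock map_polyC comp_polyC. Qed.

Lemma shiftX : shift s 'X = 'X + s%:P.
Proof. by rewrite unlock map_polyX comp_polyX. Qed.

Lemma shiftD u v : shift s (u + v) = shift s u + shift s v.
Proof. exact: (rmorphD (shift s)). Qed.

Lemma shiftB u v : shift s (u - v) = shift s u - shift s v.
Proof. exact: (rmorphB (shift s)). Qed.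

Lemma shiftZ (w : S) u : shift s (w *: u) = w%:F%:P * shift s u.
Proof.
by rewrite -mul_polyC -shiftC; apply: (rmorphM (shift s)).
Qed.
End ShiftMorphism.

Lemma rmorph_mmap (K : fieldType) (n : nat) (B C : comNzRingType)
    (phi : {rmorphism B -> C}) (h : K -> B) (v : 'I_n -> B) (p : {mpoly K[n]}) :
  phi (mmap h v p) = mmap (phi \o h) (phi \o v) p.
Proof.
rewrite /mmap rmorph_sum; apply: eq_bigr => m _; rewrite rmorphM; congr (_ * _).
by rewrite /mmap1 rmorph_prod; apply: eq_bigr => i _; rewrite rmorphXn.
Qed.

Section Chart.
Variables (K : fieldType) (n : nat) (S : idomainType) (s : {fraction S}).
Variable theta : {rmorphism {mpoly K[n]} -> {poly S}}.
Let eps : {rmorphism {mpoly K[n]} -> {poly {fraction S}}} := shift s \o theta.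

(** The coordinates c_i specialise to the polynomials v_i, so every polynomial
    expression in them specialises to a polynomial in the v_i. *)
Lemma specializes_integral (c : 'I_n -> {fraction {mpoly K[n]}})
    (v : 'I_n -> {poly S}) (const : K -> S) F u (g : {mpoly K[n]}) :
  (forall k, theta k%:MP = (const k)%:P) ->
  (forall i, specializes eps (c i) (map_poly (@tofrac S) (v i))) ->
  F = mmap (fun k => (k%:MP)%:F) c g -> specializes eps F u -> integral u.
Proof.
move=> hc hv -> hu j.
have := specializes_uniq hu (specializes_mmap g hv) => ->.
exists (mmap (fun k => (const k)%:P) v g)`_j.
rewrite -[RHS](coef_map (@tofrac S)); congr (nth 0 (polyseq _) _).
rewrite [RHS](rmorph_mmap (map_poly (@tofrac S))); apply: eq_bigr => m _.
by congr (_ * _); rewrite /eps /= hc shiftC map_polyC.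
Qed.
End Chart.

Lemma ord3P (P : 'I_3 -> Prop) : P var_x -> P var_y -> P var_z -> forall i, P i.
Proof.
move=> hx hy hz [[|[|[|//]]] hi].
- by rewrite (_ : Ordinal hi = var_x) //; apply: val_inj.
- by rewrite (_ : Ordinal hi = var_y) //; apply: val_inj.
by rewrite (_ : Ordinal hi = var_z) //; apply: val_inj.
Qed.

(** Below, d is the total derivative and theta writes polynomials in coordinates
    adapted to a chart, the outer variable being the one that the chart moves. *)
Section Charts.
Variables (K M : fieldType).
Local Notation A := {mpoly K[3]}.
Local Notation S := {poly M}.
Variables (d : A -> A).
Hypothesis dD : forall u v, d (u + v) = d u + d v.
Hypothesis dM : forall u v, d (u * v) = d u * v + u * d v.
Variable theta : {rmorphism A -> {poly S}}.
Variable const : K -> S.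
Hypothesis theta_const : forall k, theta k%:MP = (const k)%:P.

Definition regular_in (c : 3.-tuple {fraction A}) : Prop :=
  forall j : 'I_3, exists g : A,
    fracder d (tnth c j) = mmap (fun k => (k%:MP)%:F) (tnth c) g.

Variables (x y z alpha : A) (a : M).
Hypotheses (theta_alpha : theta alpha = a%:P%:P) (d_alpha : d alpha = 0).

Section Integral.
Variables (s : {fraction S}) (c : 3.-tuple {fraction A}).
Let eps : {rmorphism A -> {poly {fraction S}}} := shift s \o theta.
Variable v : 'I_3 -> {poly S}.
Hypothesis cv : forall i, specializes eps (tnth c i) (map_poly (@tofrac S) (v i)).

Lemma regular_integral j u : regular_in c ->
  specializes eps (fracder d (tnth c j)) u -> integral u.
Proof.
by move=> /(_ j)[g hg]; apply: (specializes_integral theta_const cv hg).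
Qed.

Lemma eps_const p (w : S) : theta p = w%:P -> eps p = (w%:F)%:P.
Proof. by move=> h; apply: etrans (congr1 (shift _) h) (shiftC _ _). Qed.

Lemma specializes_const p (w : S) : theta p = w%:P ->
  specializes eps p%:F (map_poly (@tofrac S) w%:P).
Proof.
by move=> /eps_const h; rewrite map_polyC -h; apply: specializes_tofrac.
Qed.

Lemma specializes_X p (w : S) : theta p = 'X + w%:P ->
  specializes eps p%:F (map_poly (@tofrac S) ('X + w%:P) + s%:P).
Proof.
move=> h; rewrite rmorphD /= map_polyX map_polyC addrAC -shiftX -(shiftC s) -rmorphD -h.
exact: (specializes_tofrac eps).
Qed.
End Integral.

(** The substitution z + a/(x - r) for z sends z - alpha/l to z, and the
    derivative of z - alpha/l is that of z plus alpha/l^2 times that of l. *)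
Lemma chart_pole (l : A) (r : M) (x' y' : S) :
  theta x = x'%:P -> theta y = y'%:P -> theta z = 'X ->
  theta l = ('X - r%:P)%:P ->
  regular_in [tuple x%:F; y%:F; z%:F - alpha%:F / l%:F] ->
  [/\ integral (shift (pole a r) (theta (d x))),
      integral (shift (pole a r) (theta (d y))) &
      integral (shift (pole a r) (theta (d z))
        + (a%:P%:F / ('X - r%:P)%:F ^+ 2)%:P * shift (pole a r) (theta (d l)))].
Proof.
move=> hx hy hz hl R.
pose eps : {rmorphism A -> {poly {fraction S}}} := shift (pole a r) \o theta.
have d0 : ('X - r%:P)%:F != 0 :> {fraction S}.
  by rewrite tofrac_eq0 polyXsubC_eq0.
have l0 : l != 0.
  by apply: contra_neq d0 => e; move: hl; rewrite e rmorph0 => /esym/eqP;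
     rewrite polyC_eq0 => /eqP ->; rewrite tofrac0.
have epsl : eps l = _ := eps_const (pole a r) hl; have epsa : eps alpha = _ :=
  eps_const (pole a r) theta_alpha.
have ul : eps l \is a GRing.unit by rewrite epsl poly_unitE size_polyC d0 coefC unitfE d0.
pose v := tnth [tuple x'%:P; y'%:P; 'X : {poly S}].
have cv i : specializes eps (tnth [tuple x%:F; y%:F; z%:F - alpha%:F / l%:F] i)
    (map_poly (@tofrac S) (v i)).
  elim/ord3P: i; rewrite /v !(tnth_nth 0) /=.
  - exact: specializes_const.
  - exact: specializes_const.
  rewrite -mulNr -tofracN -[X in specializes _ _ X](addrK (pole a r)%:P) -polyCN.
  apply: specializesD.
    by rewrite -['X]addr0 -polyC0; apply: specializes_X; rewrite polyC0 addr0.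
  apply: specializes_div => //; rewrite (rmorphN eps) epsl epsa -polyCM mulNr polyCN.
  by congr (- _%:P); apply: divfK.
split.
- apply: (regular_integral cv (j := var_x) R); rewrite (tnth_nth 0) /= fracder_tofrac //.
  exact: (specializes_tofrac eps).
- apply: (regular_integral cv (j := var_y) R); rewrite (tnth_nth 0) /= fracder_tofrac //.
  exact: (specializes_tofrac eps).
apply: (regular_integral cv (j := var_z) R); rewrite (tnth_nth 0) /= fracder_subV //.
apply: specializesD; first exact: (specializes_tofrac eps).
apply: specializesM; last exact: (specializes_tofrac eps).
rewrite -tofracXn; apply: specializes_div; first by rewrite rmorphXn unitrX.
rewrite (rmorphXn eps) epsl epsa -[X in _ * X]polyC_exp -polyCM.
by congr (_%:P); apply: divfK; apply: expf_neq0.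
Qed.

(** The substitution x - a/z for x sends x + alpha/z and y + alpha/z to
    polynomials, as x - y is fixed. *)
Lemma chart_infty (w : S) : a != 0 ->
  theta x = 'X -> theta y = 'X + w%:P -> theta z = ('X)%:P ->
  regular_in [tuple x%:F + alpha%:F / z%:F; y%:F + alpha%:F / z%:F; z%:F] ->
  let s := (- a)%:P%:F / 'X%:F in
  let integ2 g := integral (shift s g
    + ((- a)%:P%:F / 'X%:F ^+ 2)%:P * shift s (theta (d z))) in
  [/\ integral (shift s (theta (d z))), integ2 (theta (d x)) & integ2 (theta (d y))].
Proof.
move=> a0 hx hy hz R s integ2.
pose eps : {rmorphism A -> {poly {fraction S}}} := shift s \o theta.
have d0 : 'X%:F != 0 :> {fraction S} by rewrite tofrac_eq0 polyX_eq0.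
have z0 : z != 0.
  by apply: contra_neq d0 => e; move: hz; rewrite e rmorph0 => /esym/eqP;
     rewrite polyC_eq0 => /eqP ->; rewrite tofrac0.
have epsz : eps z = _ := eps_const s hz; have epsa : eps alpha = _ :=
  eps_const s theta_alpha.
have uz : eps z \is a GRing.unit by rewrite epsz poly_unitE size_polyC d0 coefC unitfE d0.
have saz : specializes eps (alpha%:F / z%:F) (- s)%:P.
  apply: specializes_div => //; rewrite epsz epsa -polyCM mulNr; congr (_%:P).
  by rewrite [X in - X](divfK d0) polyCN tofracN opprK.
pose v := tnth [tuple 'X; 'X + w%:P; ('X)%:P : {poly S}].
set c := [tuple _; _; _] in R.
have cv i : specializes eps (tnth c i) (map_poly (@tofrac S) (v i)).
  elim/ord3P: i; rewrite /v !(tnth_nth 0) /=.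
  - rewrite -[X in specializes _ _ X](addrK s%:P) -polyCN; apply: specializesD => //.
    by rewrite -['X]addr0 -polyC0; apply: specializes_X; rewrite polyC0 addr0.
  - rewrite -[X in specializes _ _ X](addrK s%:P) -polyCN; apply: specializesD => //.
    exact: specializes_X.
  exact: specializes_const.
have I2 t : specializes eps ((d t)%:F - alpha%:F / z%:F ^+ 2 * (d z)%:F)
   (shift s (theta (d t)) + ((- a)%:P%:F / 'X%:F ^+ 2)%:P * shift s (theta (d z))).
  apply: specializesD; first exact: (specializes_tofrac eps).
  rewrite -mulNr -mulNr -tofracN -tofracXn; apply: specializesM;
    last exact: (specializes_tofrac eps).
  apply: specializes_div; first by rewrite rmorphXn unitrX.
  rewrite (rmorphXn eps)
    (rmorphN eps) epsz epsa -[X in _ * X]polyC_exp -polyCM -[RHS]polyCN.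
  rewrite -tofracN -[in RHS]polyCN; congr (_%:P); apply: divfK; exact: expf_neq0.
split.
- apply: (regular_integral cv (j := var_z) R); rewrite (tnth_nth 0) /= fracder_tofrac //.
  exact: (specializes_tofrac eps).
- by apply: (regular_integral cv (j := var_x) R); rewrite (tnth_nth 0) /= fracder_addV.
by apply: (regular_integral cv (j := var_y) R); rewrite (tnth_nth 0) /= fracder_addV.
Qed.

End Charts.

(** * The coordinates x - y, x and z *)

Lemma mmapX_coord (n : nat) (R S : nzRingType) (f : {rmorphism R -> S})
  (h : 'I_n -> S) i :
  mmap f h 'X_i = h i.
Proof. by rewrite mmapX mmap1U. Qed.

Section Fibred.
Variable K : fieldType.
Local Notation A := {mpoly K[3]}.
Local Notation T := {poly {poly {poly K}}}.

Definition fibre_const : {rmorphism K -> T} := polyC \o (polyC \o polyC).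
(** The variables, from the innermost, are q = x - y, x and z. *)
Definition fibre_coord : 'I_3 -> T :=
  tnth [tuple ('X)%:P; ('X - ('X)%:P)%:P; 'X].
Definition fibred : {rmorphism A -> T} := mmap fibre_const fibre_coord.

Definition eval_to (B : comNzRingType) (C : comNzRingType) (g : {rmorphism B -> C})
  (c : C) :
  {rmorphism {poly B} -> C} := horner_eval c \o map_poly g.

Definition unfibred : {rmorphism T -> A} :=
  eval_to (eval_to (eval_to (@mpolyC 3 K) ('X_var_x - 'X_var_y)) 'X_var_x) 'X_var_z.

Lemma eval_toC (B C : comNzRingType) (g : {rmorphism B -> C}) c b :
  eval_to g c b%:P = g b.
Proof. by rewrite /eval_to /= map_polyC /horner_eval hornerC. Qed.

Lemma eval_toX (B C : comNzRingType) (g : {rmorphism B -> C}) c :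
  eval_to g c 'X = c.
Proof. by rewrite /eval_to /= map_polyX /horner_eval hornerX. Qed.

Lemma fibredK : cancel fibred unfibred.
Proof.
have hC c : unfibred c%:P%:P%:P = c%:MP by rewrite /unfibred !eval_toC.
have hX : unfibred ('X)%:P = 'X_var_x by rewrite /unfibred eval_toC eval_toX.
have hY : unfibred ('X - ('X)%:P)%:P = 'X_var_y.
  rewrite /unfibred eval_toC rmorphB eval_toX eval_toC eval_toX.
  by rewrite opprB addrC subrK.
have hZ : unfibred 'X = 'X_var_z by rewrite /unfibred eval_toX.
move=> p; rewrite [LHS](rmorph_mmap unfibred) [RHS]mpolyE /mmap.
apply: eq_bigr => m _; rewrite -mul_mpolyC; congr (_ * _); first exact: hC.
rewrite mpolyXE_id; apply: eq_bigr => i _; congr (_ ^+ _).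
by move: i; apply: ord3P.
Qed.

(** A bound on the total degree in q and x. *)
Definition tdeg_lt n (w : {poly {poly K}}) :=
  forall i, (size (w`_i)%R <= n - i)%N.

Lemma tdeg_ltX n w : tdeg_lt n w -> tdeg_lt n.+1 ('X * w).
Proof.
move=> h i; rewrite coefXM; case: i => [|i] /=; first by rewrite size_poly0.
by rewrite subSS.
Qed.

Lemma tdeg_ltY n w : tdeg_lt n w -> tdeg_lt n.+1 (('X - ('X)%:P) * w).
Proof.
move=> h i; rewrite mulrBl coefB coefCM.
rewrite (leq_trans (size_polyD _ _)) // size_polyN geq_max (tdeg_ltX h) /=.
have [->|w0] := eqVneq w`_i 0; first by rewrite mulr0 size_poly0.
have w1 : (0 < size (w`_i)%R)%N by rewrite size_poly_gt0.
by have := h i; rewrite mulrC size_mulX //; move: (size _) w1 => j; lia.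
Qed.

Lemma tdeg_lt_monom a b :
  tdeg_lt (a + b).+1 ('X ^+ a * ('X - ('X)%:P) ^+ b).
Proof.
elim: a => [|a IH]; last by rewrite exprS -mulrA addSn; apply: tdeg_ltX.
rewrite expr0 mul1r add0n; elim: b => [|b IH]; last by rewrite exprS; apply: tdeg_ltY.
by move=> [|i]; rewrite coef1 ?size_poly1 ?size_poly0.
Qed.

Lemma size_coef_fibred (p : A) n k i : (msize p <= n)%N ->
  (size ((fibred p)`_k`_i)%R <= n - k - i)%N.
Proof.
move=> sp; rewrite /fibred /= /mmap !coef_sum big_seq_cond.
elim/big_ind: _ => [|u v hu hv|m /andP[/msize_mdeg_lt hm _]].
- by rewrite size_poly0.
- by rewrite (leq_trans (size_polyD _ _)) // geq_max hu.
move: hm; rewrite mdegE /mmap1 !big_ord_recl !big_ord0 /= /fibre_coord !(tnth_nth 0) /=.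
set m0 := m ord0; set m1 := m _; set m2 := m _; rewrite addn0 mulr1 => hm.
rewrite -!polyC_exp mulrA -polyCM mulrA -polyCM coefCM coefXn.
have [->|_] := eqVneq k m2; last by rewrite mulr0 coef0 size_poly0.
rewrite mulr1 -mulrA coefCM.
have [->|c0] := eqVneq p@_m 0; first by rewrite polyC0 mul0r size_poly0.
rewrite mul_polyC size_scale //; apply: leq_trans (tdeg_lt_monom m0 m1 i) _.
by lia.
Qed.
End Fibred.

(** * Uniqueness over the coefficient field *)

Lemma pchar0_inj (R S : nzRingType) (phi : {rmorphism R -> S}) :
  injective phi -> [pchar R] =i pred0 -> [pchar S] =i pred0.
Proof.
move=> inj R0 p; rewrite -(R0 p) !inE -(rmorph_nat phi).
by rewrite -[X in phi _ == X](rmorph0 phi) (inj_eq inj).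
Qed.

Lemma polyXsub_sub1 (R : nzRingType) (c : R) :
  ('X - c%:P)%:P - 1 = ('X - (c + 1)%:P)%:P :> {poly {poly R}}.
Proof. by rewrite -polyC1 -polyCB (polyCD c) polyC1 opprD addrA. Qed.

Lemma uniq_generic_roots (K : fieldType) (e : K) : e != 0 ->
  uniq [:: 0; e%:P%:F; 'X%:F; 'X%:F + 1 : {fraction {poly K}}].
Proof.
move=> e0; have tofrac_inj : injective (@tofrac {poly K}).
  by move=> u v /eqP; rewrite tofrac_eq => /eqP.
have E : [seq u%:F | u <- [:: 0; e%:P; 'X; 'X + 1 : {poly K}]]
    = [:: 0; e%:P%:F; 'X%:F; 'X%:F + 1].
  by rewrite /= tofrac0 tofracD tofrac1.
rewrite -E map_inj_uniq //= !inE !negb_or -!andbA.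
have ne (u v : {poly K}) i : u`_i != v`_i -> u != v by apply: contra_neq => ->.
have o := oner_neq0 K; apply/and5P; split=> //.
- by apply: (ne _ _ 0%N); rewrite coef0 coefC eq_sym.
- by apply: (ne _ _ 1%N); rewrite coef0 coefX eq_sym.
- by apply: (ne _ _ 1%N); rewrite coef0 coefD coefX coef1 addr0 eq_sym.
- by apply: (ne _ _ 1%N); rewrite coefC coefX eq_sym.
apply/and3P; split=> //.
- by apply: (ne _ _ 1%N); rewrite coefC coefD coefX coef1 addr0 eq_sym.
by apply: (ne _ _ 0%N); rewrite coefD coefX coef1 add0r eq_sym.
Qed.

Lemma generic_fib_w (K : fieldType) (e : K) :
  fib_w (e%:P%:F) ('X%:F : {fraction {poly K}}) = (fib_w e%:P 'X)%:F.
Proof. exact/esym/(rmorph_fib_w (@tofrac {poly K})). Qed.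

Lemma generic_fib_w_neq0 (K : fieldType) (K0 : [pchar K] =i pred0) (e : K) :
  fib_w (e%:P%:F) ('X%:F : {fraction {poly K}}) != 0.
Proof.
rewrite generic_fib_w tofrac_eq0; apply/eqP => /(congr1 (fun u : {poly K} => u`_1)) /eqP.
rewrite /fib_w coefB coefD mulr_natl coefMn coefX coef1 coefC coef0 /= addr0 subr0.
by have /pcharf0P -> := K0.
Qed.

Lemma scale_coef (L : comNzRingType) (A C D : L) (u v : {poly L}) j :
  A * D = C -> (A%:P * u + C%:P * v)`_j = A * (u + D%:P * v)`_j.
Proof. by move=> <-; rewrite !coefD !coefCM mulrDr mulrA. Qed.

Lemma swapXYB (R : nzRingType) (u v : {poly {poly R}}) :
  swapXY (u - v) = swapXY u - swapXY v.
Proof. exact: raddfB. Qed.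

(** The derivatives of x + a2/z and y + a2/z differ by that of x - y. *)
Lemma laurent_of_infty (M : fieldType) (c : M) (f g p : {poly {poly M}}) :
  let s := c%:P%:F / 'X%:F in
  let integ2 h := integral (shift s (swapXY h)
    + (c%:P%:F / 'X%:F ^+ 2)%:P * shift s (swapXY p)) in
  integral (shift s (swapXY p)) -> integ2 f -> integ2 g ->
  [/\ laurent_integral c 0 (swapXY p), laurent_integral c 0 (swapXY (f - g)) &
      laurent_integral c 2 ('X^2 *: swapXY f + c%:P *: swapXY p)].
Proof.
move=> s integ2 Ip If Ig; split=> j.
- by have [h hh] := Ip j; exists h; rewrite expr0 mul1r.
- have [h1 e1] := If j; have [h2 e2] := Ig j; exists (h1 - h2).
  rewrite swapXYB expr0 mul1r tofracB -e1 -e2 shiftB -coefB.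
  by rewrite opprD addrACA subrr addr0.
have [h e1] := If j; exists h.
rewrite tofracM -e1 shiftD (shiftZ _ 'X^2) (shiftZ _ c%:P); apply: scale_coef.
rewrite mulrCA tofracXn mulfV ?mulr1 //.
by rewrite expf_neq0 // tofrac_eq0 polyX_eq0.
Qed.

(** At q0 = (e - 1)/2 the quadratic factors of a0, a1, 2 a2, a3, a4 all take the
    value - q0 (q0 + 1). *)
Lemma fib_v2_at_root (K : fieldType) (e a0 a1 a2 a3 a4 q0 : K) :
  a0 + a1 + 2 * a2 + a3 + a4 = 1 -> e = 2 * q0 + 1 ->
  fib_v2 e a0 a1 a2 a3 a4 q0 = - (q0 * (q0 + 1)).
Proof.
move=> sum_a ->.
transitivity (- (q0 * (q0 + 1)) * (a0 + a1 + 2 * a2 + a3 + a4)).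
  by rewrite /fib_v2; ring.
by rewrite sum_a mulr1.
Qed.

(** Here B and V are the coefficients of x^4 z and x^2.  Eliminating c gives
    B v = - 2 w V with v = fib_v2 and w = 2 (q - q0); v(q0) is not zero because
    q0 = 0 means e = 1 and q0 = - 1 means e = - 1.  So q - q0 divides B, and the
    quotient has degree 0. *)
Lemma multiplier_const (K : fieldType) (K0 : [pchar K] =i pred0)
    (e a0 a1 a2 a3 a4 : K) (B V : {poly K}) (c : {fraction {poly K}})
    (inM := fun k : K => k%:P%:F : {fraction {poly K}}) :
  a0 + a1 + 2 * a2 + a3 + a4 = 1 -> e != 1 -> e != - 1 -> (size B <= 2)%N ->
  B%:F = - 2 * fib_w (inM e) 'X%:F * c ->
  V%:F = c * fib_v2 (inM e) (inM a0) (inM a1) (inM a2) (inM a3) (inM a4) 'X%:F ->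
  exists k : K, c = inM k.
Proof.
move=> sum_a e1 eN1 sB; rewrite {}/inM.
rewrite -(rmorph_fib_v2 (@tofrac {poly K})) (generic_fib_w e) => hB hV.
have two0 : 2 != 0 :> K by have /pcharf0P -> := K0.
have [q0 eE] : exists q0, e = 2 * q0 + 1 by exists ((e - 1) / 2); field.
have NE : fib_w e%:P 'X = 2 * ('X - q0%:P).
  by rewrite /fib_w eE polyCD polyCM polyC_natr polyC1; ring.
have root_B : root B q0.
  have : B * fib_v2 e%:P a0%:P a1%:P a2%:P a3%:P a4%:P 'X = - (2 * fib_w e%:P 'X * V).
    apply/eqP; rewrite -(@tofrac_eq {poly K}) tofracM tofracN 2!tofracM hB hV.
    have aux (L : fieldType) (u v w : L) : - 2 * u * v * w = - (2 * u * (v * w)) by ring.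
    by rewrite tofracMn tofrac1 aux.
  have n2E : (fib_v2 e%:P a0%:P a1%:P a2%:P a3%:P a4%:P 'X).[q0]
      = fib_v2 e a0 a1 a2 a3 a4 q0.
    pose ev : {rmorphism {poly K} -> K} := horner_eval q0.
    have evC k : ev k%:P = k by apply: hornerC.
    have evX : ev 'X = q0 by apply: hornerX.
    by rewrite -[LHS]/(ev _) rmorph_fib_v2 evX !evC.
  move/(congr1 (horner^~ q0)); rewrite hornerM n2E NE hornerN 3!hornerM.
  rewrite hornerXsubC subrr !mulr0 mul0r oppr0 (fib_v2_at_root sum_a eE) => /eqP.
  rewrite mulf_eq0 oppr_eq0 mulf_eq0.
  case/orP => // /orP[/eqP z|].
    by move: e1; rewrite eE z mulr0 add0r eqxx.
  rewrite addr_eq0 => /eqP z.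
  by move: eN1; rewrite eE z; case/eqP; ring.
have /factor_theorem[B' BE] := root_B.
have sB' : (size B' <= 1)%N.
  have [->|B'0] := eqVneq B' 0; first by rewrite size_poly0.
  by move: sB; rewrite BE size_Mmonic ?monicXsubC // size_XsubC addn2.
have [b B'E] : exists b, B' = b%:P by exists B'`_0; exact: size1_polyC.
exists (- b / 4).
have four0 : 4 != 0 :> K by have /pcharf0P -> := K0.
have D0 : ('X - q0%:P)%:F != 0 :> {fraction {poly K}}.
  by rewrite tofrac_eq0 polyXsubC_eq0.
have two0F : (4%:P)%:F != 0 :> {fraction {poly K}} by rewrite tofrac_eq0 polyC_eq0.
apply: (mulIf D0); apply: (mulfI two0F).
move: hB; rewrite NE BE B'E !tofracM => hB.
have -> : 4%:P%:F * (c * ('X - q0%:P)%:F) = - (- 2 * (2%:F * ('X - q0%:P)%:F) * c).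
  have aux (L : fieldType) (u v : L) : 4 * (v * u) = - (- 2 * (2 * u) * v) by ring.
  by rewrite polyC_natr !tofracMn !tofrac1 aux.
rewrite -hB [RHS]mulrA -[in RHS]tofracM -polyCM mulrCA mulfV // mulr1.
by rewrite polyCN tofracN mulNr.
Qed.

Section RmorphD4.
Variables (R S : comNzRingType) (phi : {rmorphism R -> S}).
Variables (e a0 a1 a2 a3 a4 x y z : R).
Let rm := (rmorphD phi, rmorphN phi, rmorphM phi, rmorphXn phi,
  rmorph_nat phi, rmorph1 phi).

Lemma rmorph_D4_P : phi (D4_P e a0 a1 a2 a3 a4 x y z) =
  D4_P (phi e) (phi a0) (phi a1) (phi a2) (phi a3) (phi a4) (phi x) (phi y) (phi z).
Proof. by rewrite /D4_P !rm. Qed.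

Lemma rmorph_D4_Q : phi (D4_Q e a0 a1 a2 a3 a4 x y z) =
  D4_Q (phi e) (phi a0) (phi a1) (phi a2) (phi a3) (phi a4) (phi x) (phi y) (phi z).
Proof. by rewrite /D4_Q !rm. Qed.

Lemma rmorph_D4_R : phi (D4_R e a0 a1 a2 a3 a4 x y z) =
  D4_R (phi e) (phi a0) (phi a1) (phi a2) (phi a3) (phi a4) (phi x) (phi y) (phi z).
Proof. by rewrite /D4_R !rm. Qed.
End RmorphD4.

Section Uniqueness.
Variables (K : fieldType) (K0 : [pchar K] =i pred0).
Local Notation A := {mpoly K[3]}.
Local Notation M := {fraction {poly K}}.
Variables (e a0 a1 a2 a3 a4 : K).
Hypotheses (e_neq0 : e != 0) (e_neq1 : e != 1) (e_neqN1 : e != - 1)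
  (a0_neq0 : a0 != 0) (a1_neq0 : a1 != 0)
  (a2_neq0 : a2 != 0) (a3_neq0 : a3 != 0) (a4_neq0 : a4 != 0).
Hypothesis sum_a : a0 + a1 + 2 * a2 + a3 + a4 = 1.
Variable d : A -> A.
Hypothesis dD : forall u v, d (u + v) = d u + d v.
Hypothesis dM : forall u v, d (u * v) = d u * v + u * d v.
Hypothesis d_const : forall k, k \in [:: e; a0; a1; a2; a3; a4] -> d k%:MP = 0.
Hypothesis size_d : forall i, (msize (d 'X_i) <= 7)%N.

Local Notation x := ('X_var_x : A).
Local Notation y := ('X_var_y : A).
Local Notation z := ('X_var_z : A).

Hypothesis R0 : regular_in d
  [tuple (x - e%:MP)%:F; y%:F; z%:F - (a0%:MP)%:F / (x - e%:MP)%:F].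
Hypothesis R1 : regular_in d [tuple x%:F; y%:F; z%:F - (a1%:MP)%:F / x%:F].
Hypothesis R2 : regular_in d
  [tuple x%:F + (a2%:MP)%:F / z%:F; y%:F + (a2%:MP)%:F / z%:F; z%:F].
Hypothesis R3 : regular_in d
  [tuple x%:F; (y - 1)%:F; z%:F - (a3%:MP)%:F / (y - 1)%:F].
Hypothesis R4 : regular_in d [tuple x%:F; y%:F; z%:F - (a4%:MP)%:F / y%:F].

Let inM : {rmorphism K -> M} := @tofrac {poly K} \o polyC.
Let q : M := ('X)%:F.

Definition theta : {rmorphism A -> {poly {poly M}}} :=
  map_poly (map_poly (@tofrac {poly K})) \o @fibred K.

Lemma theta_const k : theta k%:MP = constC M (inM k).
Proof. by rewrite /theta /= mmapC /= !map_polyC /= map_polyC. Qed.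

Lemma theta_x : theta x = ('X)%:P.
Proof.
by rewrite /theta /= (mmapX_coord (fibre_const K)) /fibre_coord (tnth_nth 0)
  /= map_polyC /= map_polyX.
Qed.

Lemma theta_y : theta y = ('X - q%:P)%:P.
Proof.
rewrite /theta /= (mmapX_coord (fibre_const K)) /fibre_coord (tnth_nth 0) /= map_polyC /=.
by rewrite rmorphB /= map_polyX map_polyC.
Qed.

Lemma theta_z : theta z = 'X.
Proof.
by rewrite /theta /= (mmapX_coord (fibre_const K)) /fibre_coord (tnth_nth 0) /= map_polyX.
Qed.

Lemma theta_inj : injective theta.
Proof.
apply: inj_comp; last exact: can_inj (@fibredK K).
apply: map_inj_poly; last exact: rmorph0.
apply: map_inj_poly; last exact: rmorph0.
by move=> u v /eqP; rewrite tofrac_eq => /eqP.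
Qed.

Lemma coef_theta (p : A) k i : (theta p)`_k`_i = ((fibred K p)`_k`_i)%:F.
Proof. by rewrite /theta /= !coef_map. Qed.

Lemma size_theta_coef (p : A) k : (msize p <= 7)%N -> (size ((theta p)`_k)%R <= 7 - k)%N.
Proof.
move=> sp; apply/leq_sizeP => j j7; rewrite coef_theta.
have := size_coef_fibred k j sp; rewrite (eqP (_ : 7 - k - j == 0)%N) ?subn_eq0 //.
by rewrite leqn0 size_poly_eq0 => /eqP ->; rewrite tofrac0.
Qed.

Lemma size_theta (p : A) : (msize p <= 7)%N -> (size (theta p) <= 7)%N.
Proof.
move=> sp; apply/leq_sizeP => k k7; apply/eqP.
rewrite -size_poly_eq0 -leqn0; apply: leq_trans (size_theta_coef k sp) _.
by rewrite leqn0 subn_eq0.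
Qed.

Let d1 := derivation1 dM.
Let dN := derivationN dD.

Let dXe : d (x - e%:MP) = d x.
Proof. by rewrite dD dN d_const ?inE ?eqxx // subr0. Qed.

Let dY1 : d (y - 1) = d y.
Proof. by rewrite dD dN d1 subr0. Qed.

Let thc k : theta k%:MP = ((inM k)%:P)%:P := theta_const k.

Let C0 : chart_regular (inM a0) (inM e) (theta (d x)) (theta (d y)) (theta (d z)).
Proof.
have hx : theta (x - e%:MP) = ('X - (inM e)%:P)%:P.
  by rewrite rmorphB theta_x thc polyCB.
have [] := chart_pole dD dM thc (thc a0) (d_const _) hx theta_y theta_z hx R0.
  by rewrite !inE eqxx orbT.
by rewrite dXe => h1 h2 h3; exact: And3 h1 h2 h3.
Qed.

Let C1 : chart_regular (inM a1) 0 (theta (d x)) (theta (d y)) (theta (d z)).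
Proof.
have hx : theta x = ('X - 0%:P)%:P by rewrite theta_x polyC0 subr0.
have [] := chart_pole dD dM thc (thc a1) (d_const _) theta_x theta_y theta_z hx R1.
  by rewrite !inE eqxx !orbT.
by move=> h1 h2 h3; exact: And3 h1 h2 h3.
Qed.

Let C3 : chart_regular (inM a3) (q + 1) (theta (d y)) (theta (d x)) (theta (d z)).
Proof.
have hy : theta (y - 1) = ('X - (q + 1)%:P)%:P.
  rewrite rmorphB theta_y (rmorph1 theta : theta 1 = 1); exact: polyXsub_sub1.
have [] := chart_pole dD dM thc (thc a3) (d_const _) theta_x hy theta_z hy R3.
  by rewrite !inE eqxx !orbT.
by rewrite dY1 => h1 h2 h3; exact: And3 h2 h1 h3.
Qed.

Let C4 : chart_regular (inM a4) q (theta (d y)) (theta (d x)) (theta (d z)).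
Proof.
have [] := chart_pole dD dM thc (thc a4) (d_const _) theta_x theta_y theta_z theta_y R4.
  by rewrite !inE eqxx !orbT.
by move=> h1 h2 h3; exact: And3 h2 h1 h3.
Qed.

Let theta' : {rmorphism A -> {poly {poly M}}} := @swapXY M \o theta.

Let thetaE' p : theta' p = swapXY (theta p). Proof. by []. Qed.

Let thc' k : theta' k%:MP = ((inM k)%:P)%:P.
Proof. by rewrite thetaE' thc swapXY_polyC map_polyC. Qed.

Let C2 : let s := (- inM a2)%:P%:F / 'X%:F in
  let integ2 g := integral (shift s g
      + ((- inM a2)%:P%:F / 'X%:F ^+ 2)%:P * shift s (theta' (d z))) in
  [/\ integral (shift s (theta' (d z))), integ2 (theta' (d x)) & integ2 (theta' (d y))].
Proof.
apply: (chart_infty dD dM thc' (thc' a2) (d_const _) (w := - q%:P) _ _ _ _ R2).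
- by rewrite !inE eqxx !orbT.
- by rewrite fmorph_eq0.
- by rewrite thetaE' theta_x swapXY_polyC map_polyX.
- rewrite thetaE' theta_y swapXY_polyC rmorphB /= map_polyX map_polyC /=.
  by rewrite polyCN.
by rewrite thetaE' theta_z swapXY_X.
Qed.

Let distinct : uniq [:: 0; inM e; q; q + 1].
Proof. exact: uniq_generic_roots. Qed.

Let w_neq0 : fib_w (inM e) q != 0.
Proof. exact: generic_fib_w_neq0. Qed.

Let C2' :
  [/\ laurent_integral (- inM a2) 0 (swapXY (theta (d z))),
      laurent_integral (- inM a2) 0 (swapXY (theta (d x) - theta (d y))) &
      laurent_integral (- inM a2) 2
        ('X^2 *: swapXY (theta (d x)) + (- inM a2)%:P *: swapXY (theta (d z)))].
Proof. by have [h1 h2 h3] := C2; exact: laurent_of_infty h1 h2 h3. Qed.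

Lemma D4_unique : exists k : K,
  [/\ d x = k *: D4_P e%:MP a0%:MP a1%:MP a2%:MP a3%:MP a4%:MP x y z,
      - d y = k *: D4_Q e%:MP a0%:MP a1%:MP a2%:MP a3%:MP a4%:MP x y z &
      d z = k *: D4_R e%:MP a0%:MP a1%:MP a2%:MP a3%:MP a4%:MP x y z].
Proof.
have M0 : [pchar M] =i pred0.
  apply: (pchar0_inj (phi := inM)) K0 => u v /eqP.
  by rewrite /inM /= tofrac_eq => /eqP /polyC_inj.
have nzM (a : K) : a != 0 -> inM a != 0 by rewrite fmorph_eq0.
have sumM : inM a0 + inM a1 + 2 * inM a2 + inM a3 + inM a4 = 1.
  transitivity (inM (a0 + a1 + 2 * a2 + a3 + a4)); last by rewrite sum_a rmorph1.
  by rewrite !(rmorphD inM) (rmorphM inM) rmorph_nat.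
have [L1 L2 L3] := C2'.
have [c [E1 E2 E3 hB hV]] := fibre_D4 M0 (nzM _ e_neq0) (nzM _ a0_neq0) (nzM _ a1_neq0)
  (nzM _ a2_neq0) (nzM _ a3_neq0) (nzM _ a4_neq0) sumM distinct w_neq0
  (size_theta (size_d _)) (fun k => size_theta_coef k (size_d _))
  (size_theta (size_d _)) (fun k => size_theta_coef k (size_d _))
  (size_theta (size_d _)) (fun k => size_theta_coef k (size_d _))
  C1 C0 C4 C3 L1 L2 L3.
have sB : (size ((fibred K (d x))`_1`_4)%R <= 2)%N
  by exact: (size_coef_fibred 1 4 (size_d var_x)).
rewrite !coef_theta in hB hV.
have [k ck] := multiplier_const K0 sum_a e_neq1 e_neqN1 sB hB hV.
have thy : theta y = 'X%:P - constC M q by rewrite theta_y polyCB.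
have thk : theta k%:MP = constC M c by rewrite ck theta_const.
exists k; split; apply: theta_inj; rewrite -mul_mpolyC (rmorphM theta) thk.
- by rewrite rmorph_D4_P !theta_const theta_x thy theta_z.
- by rewrite (rmorphN theta) rmorph_D4_Q !theta_const theta_x thy theta_z.
by rewrite rmorph_D4_R !theta_const theta_x thy theta_z.
Qed.
End Uniqueness.

(** * The total derivative *)

Section TotalDerivative.
Variable R : realType.

Lemma ddtD (u v : Ct R) : ddt (u + v) = ddt u + ddt v.
Proof. exact: fracderD (@derivD R[i]) (@derivM R[i]) _ _. Qed.

Lemma ddtM (u v : Ct R) : ddt (u * v) = ddt u * v + u * ddt v.
Proof. exact: fracderM (@derivM R[i]) _ _. Qed.

Lemma ddt_constt c : ddt (constt c : Ct R) = 0.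
Proof. by rewrite [LHS](fracder_tofrac (@derivM R[i])) derivC tofrac0. Qed.

Lemma ddt_is_zmod_morphism : zmod_morphism (@ddt R).
Proof. by move=> u v; rewrite ddtD (derivationN ddtD). Qed.
HB.instance Definition _ :=
  GRing.isZmodMorphism.Build _ _ (@ddt R) ddt_is_zmod_morphism.

Variable f : 3.-tuple (Ctxyz R).

Lemma total_derD p q : total_der f (p + q) = total_der f p + total_der f q.
Proof.
rewrite /total_der raddfD addrACA; congr (_ + _); rewrite -big_split.
by apply: eq_bigr => j _; rewrite mderivD mulrDr.
Qed.

Lemma total_derM p q :
  total_der f (p * q) = total_der f p * q + p * total_der f q.
Proof.
rewrite /total_der map_mpoly_derivation; last exact: ddtM.
rewrite mulrDl mulrDr addrACA; congr (_ + _).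
rewrite mulr_suml mulr_sumr -big_split; apply: eq_bigr => j _.
by rewrite mderivM mulrDr; congr (_ + _); [apply: mulrA|apply: mulrCA].
Qed.

Lemma total_der_const c : total_der f (constp c) = 0.
Proof.
rewrite /total_der /constp map_mpolyC /= ddt_constt mpolyC0 add0r.
by apply: big1 => j _; rewrite mderivC mulr0.
Qed.

Lemma total_der_coord i : total_der f 'X_i = tnth f i.
Proof.
rewrite /total_der [map_mpoly _ _](_ : _ = 0) ?add0r; last first.
  apply/mpolyP => m; rewrite mcoeff_map_mpoly mcoeffX mcoeff0.
  by case: (_ == _); [apply: (derivation1 ddtM)|apply: (derivation0 ddtD)].
rewrite (bigD1 i) //= big1 ?addr0 => [|j ji].
  rewrite mderivX mnm1E eqxx scale1r (_ : (U_(i) - U_(i))%MM = 0%MM) ?mpolyX0 ?mulr1 //.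
  by apply/mnmP => j; rewrite mnmBE subnn mnm0E.
by rewrite mderivX mnm1E eq_sym (negbTE ji) scale0r mulr0.
Qed.
End TotalDerivative.

Theorem theorem2p1 (R : realType) (eta a0 a1 a2 a3 a4 : R[i])
    (eta_neq0 : eta != 0)
    (sum_a : a0 + a1 + 2 * a2 + a3 + a4 = 1)
    (* nondegeneracy; the theorem fails for every eta, a0, ..., a4 violating
       one of these *)
    (eta_neq1 : eta != 1) (eta_neqN1 : eta != - 1)
    (a0_neq0 : a0 != 0) (a1_neq0 : a1 != 0) (a2_neq0 : a2 != 0)
    (a3_neq0 : a3 != 0) (a4_neq0 : a4 != 0)
    (f : 3.-tuple (Ctxyz R))
    (* msize is 1 + the total degree in x, y, z *)
    (A1 : forall j : 'I_3, msize (tnth f j) = 7%N)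
    (A2 : forall i : 'I_5,
        polynomial_in_coordinates f
          (tnth (coordinates eta a0 a1 a2 a3 a4) i)) :
  exists b : Ct R, is_D4_system eta a0 a1 a2 a3 a4 b f.
Proof.
pose co : {rmorphism R[i] -> Ct R} := @tofrac {poly R[i]} \o polyC.
have co_inj : injective co.
  by move=> u v /eqP; rewrite /co /= tofrac_eq => /eqP /polyC_inj.
have K0 : [pchar (Ct R)] =i pred0 by apply: (pchar0_inj co_inj); exact: Num.Theory.pchar_num.
have nz u : u != 0 -> co u != 0 by rewrite fmorph_eq0.
have sumK : co a0 + co a1 + 2 * co a2 + co a3 + co a4 = 1.
  transitivity (co (a0 + a1 + 2 * a2 + a3 + a4)); last by rewrite sum_a rmorph1.
  by rewrite !(rmorphD co) (rmorphM co) rmorph_nat.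
have e1 : co eta != 1 by rewrite -(rmorph1 co) (inj_eq co_inj).
have eN1 : co eta != - 1 by rewrite -(rmorph1 co) -(rmorphN co) (inj_eq co_inj).
have dc k : k \in [:: co eta; co a0; co a1; co a2; co a3; co a4] ->
    total_der f k%:MP = 0.
  rewrite !inE.
  by case/orP=> [|/orP[|/orP[|/orP[|/orP[]]]]] /eqP ->; apply: total_der_const.
have sd i : (msize (total_der f 'X_i) <= 7)%N by rewrite total_der_coord A1.
have := A2 (Ordinal (isT : 0 < 5)%N); have := A2 (Ordinal (isT : 1 < 5)%N).
have := A2 (Ordinal (isT : 2 < 5)%N); have := A2 (Ordinal (isT : 3 < 5)%N).
have := A2 (Ordinal (isT : 4 < 5)%N).
rewrite /coordinates !(tnth_nth [tuple 0; 0; 0]) /= -!tofracB => R4 R3 R2 R1 R0.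
have [k [Ex Ey Ez]] := D4_unique K0 (nz _ eta_neq0) e1 eN1 (nz _ a0_neq0) (nz _ a1_neq0)
  (nz _ a2_neq0) (nz _ a3_neq0) (nz _ a4_neq0) sumK (@total_derD _ f) (@total_derM _ f)
  dc sd R0 R1 R2 R3 R4.
rewrite !total_der_coord in Ex Ey Ez.
have k0 : k != 0.
  apply: contra_eq_neq (A1 var_x) => k0.
  by rewrite Ex k0 scale0r msize0.
have two0 : 2 != 0 :> Ct R by have /pcharf0P -> := K0.
have et0 : constt eta != 0 :> Ct R := nz _ eta_neq0.
have u0 : 2 * constt eta != 0 :> Ct R := mulf_neq0 two0 et0.
have aux (L : fieldType) (u v : L) : u != 0 -> v != 0 -> u / (u * v) * v = 1.
  by move=> ? ?; field; apply/andP.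
have sk := aux _ _ _ u0 k0.
exists (2 * constt eta * k); split; first exact: mulf_neq0 u0 k0.
- by rewrite Ex scalerA sk scale1r.
- by rewrite scaleNr -scalerN Ey scalerA sk scale1r.
by rewrite Ez scalerA sk scale1r.
Qed.
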